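(* Let $\mathfrak{A}=\bigoplus_{i=1}^{k}M_{n_i}(\mathbb{C})$ be a finite-dimensional complex $C^\ast$-algebra (every finite-dimensional complex $C^\ast$-algebra is $\ast$-isomorphic to one of this form), and assume that $\mathfrak{A}$ is not isomorphic to $\mathbb{C}$, $\mathbb{C}\oplus\mathbb{C}$ or $M_2(\mathbb{C})$. An additive surjection $\Phi\colon\mathfrak{A}\to\mathfrak{A}$ preserves strong Birkhoff--James orthogonality (i.e. for all $a,b\in\mathfrak{A}$, if $a$ is strong Birkhoff--James orthogonal to $b$ then $\Phi(a)$ is strong Birkhoff--James orthogonal to $\Phi(b)$) if and only if there exist a permutation $\pi$ of the minimal ideals of $\mathfrak{A}$ which respects their dimension, a positive scalar $\gamma$, unitary elements $u,v\in\mathfrak{A}$, and a map $x\mapsto x^\dagger$ on $\mathfrak{A}$ which is the identity on some (possibly none) of the minimal ideals and entrywise complex conjugation with respect to a fixed orthonormal basis on the other minimal ideals, such that $$\Phi(a)=\gamma\, u\,\pi(a)^\dagger\, v\qquad\text{for all } a\in\mathfrak{A}.$$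
   Context: For elements $a,b$ of a $C^\ast$-algebra $\mathfrak{A}$, $a$ is strong Birkhoff--James orthogonal to $b$ if $\|a+bc\|\ge\|a\|$ for all $c\in\mathfrak{A}$. The $C^\ast$-norm on $\bigoplus_{i=1}^k M_{n_i}(\mathbb{C})$ is $\|A_1\oplus\dots\oplus A_k\|=\max_i\|A_i\|$ with the operator norm on each block. The minimal ideals of $\mathfrak{A}$ are its blocks $M_{n_i}(\mathbb{C})$. A permutation $\pi$ of $\{1,\dots,k\}$ with $n_{\pi(i)}=n_i$ for all $i$ (a permutation respecting dimensions) induces the linear bijection of $\mathfrak{A}$, again denoted $\pi$, given by $\bigoplus A_i\mapsto\bigoplus A_{\pi(i)}$. The map $\dagger$ acts blockwise: $(A_1\oplus\dots\oplus A_k)^\dagger=A_1^\dagger\oplus\dots\oplus A_k^\dagger$, where for each $i$ either $A_i^\dagger=A_i$ for all $A_i$, or $A_i^\dagger=\overline{A_i}$ (entrywise complex conjugate in the fixed orthonormal basis of $\mathbb{C}^{n_i}$) for all $A_i$. Additive means $\Phi(a+b)=\Phi(a)+\Phi(b)$. *)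

(* Defs.v *)
From HB Require Import structures.
From mathcomp Require Import all_boot all_order all_algebra all_fingroup.
From mathcomp Require Import complex.
From mathcomp Require Import boolp classical_sets reals.

Set Implicit Arguments.
Unset Strict Implicit.
Unset Printing Implicit Defensive.

Import Order.TTheory GRing.Theory Num.Theory.
Local Open Scope ring_scope.
Local Open Scope classical_set_scope.
Local Open Scope sesquilinear_scope.

(* [blockalg R n] is the direct sum of the matrix algebras M_(n i)(C), for
   i in 'I_k; the blocks are its minimal ideals provided every [n i] > 0. *)
Definition blockalg (R : realType) (k : nat) (n : 'I_k -> nat) : Type :=
  forall j : 'I_k, 'M[R[i]]_(n j).

Section BlockAlgebra.
Variables (R : realType) (k : nat) (n : 'I_k -> nat).
Local Notation A := (blockalg R n).
Implicit Types (a b c : A) (x y : R[i]).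

HB.instance Definition _ :=
  Choice.copy A (forall j : 'I_k, 'M[R[i]]_(n j)).

Definition blk_zero : A := fun=> 0.
Definition blk_opp a : A := fun j => - a j.
Definition blk_add a b : A := fun j => a j + b j.
Definition blk_one : A := fun=> 1%:M.
Definition blk_mul a b : A := fun j => a j *m b j.
Definition blk_scale x a : A := fun j => x *: a j.

Lemma blk_addA : associative blk_add.
Proof. by move=> a b c; apply: functional_extensionality_dep => j; exact: addrA. Qed.
Lemma blk_addC : commutative blk_add.
Proof. by move=> a b; apply: functional_extensionality_dep => j; exact: addrC. Qed.
Lemma blk_add0 : left_id blk_zero blk_add.
Proof. by move=> a; apply: functional_extensionality_dep => j; exact: add0r. Qed.
Lemma blk_addN : left_inverse blk_zero blk_opp blk_add.
Proof. by move=> a; apply: functional_extensionality_dep => j; exact: addNr. Qed.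

HB.instance Definition _ :=
  GRing.isZmodule.Build A blk_addA blk_addC blk_add0 blk_addN.

Lemma blk_mulA : associative blk_mul.
Proof. by move=> a b c; apply: functional_extensionality_dep => j; exact: mulmxA. Qed.
Lemma blk_mul1l : left_id blk_one blk_mul.
Proof. by move=> a; apply: functional_extensionality_dep => j; exact: mul1mx. Qed.
Lemma blk_mul1r : right_id blk_one blk_mul.
Proof. by move=> a; apply: functional_extensionality_dep => j; exact: mulmx1. Qed.
Lemma blk_mulDl : left_distributive blk_mul +%R.
Proof. by move=> a b c; apply: functional_extensionality_dep => j; exact: mulmxDl. Qed.
Lemma blk_mulDr : right_distributive blk_mul +%R.
Proof. by move=> a b c; apply: functional_extensionality_dep => j; exact: mulmxDr. Qed.

HB.instance Definition _ :=
  GRing.Zmodule_isPzRing.Build A blk_mulA blk_mul1l blk_mul1r blk_mulDl blk_mulDr.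

Lemma blk_scaleA x y a : blk_scale x (blk_scale y a) = blk_scale (x * y) a.
Proof. by apply: functional_extensionality_dep => j; exact: scalerA. Qed.
Lemma blk_scale1 : left_id 1 blk_scale.
Proof. by move=> a; apply: functional_extensionality_dep => j; exact: scale1r. Qed.
Lemma blk_scaleDr : right_distributive blk_scale +%R.
Proof. by move=> x a b; apply: functional_extensionality_dep => j; exact: scalerDr. Qed.
Lemma blk_scaleDl a : {morph blk_scale^~ a : x y / x + y}.
Proof. by move=> x y; apply: functional_extensionality_dep => j; exact: scalerDl. Qed.

HB.instance Definition _ := GRing.Zmodule_isLmodule.Build R[i] A
  blk_scaleA blk_scale1 blk_scaleDr blk_scaleDl.

Definition blk_star a : A := fun j => (a j) ^t*.

Definition blk_unitary a : Prop := blk_star a * a = 1 /\ a * blk_star a = 1.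

End BlockAlgebra.

Definition l2norm (R : realType) (m : nat) (x : 'cV[R[i]]_m) : R :=
  Num.sqrt (\sum_(j < m) Normc.normc (x j 0) ^+ 2).

Definition opnorm (R : realType) (m : nat) (M : 'M[R[i]]_m) : R :=
  sup [set l2norm (M *m x) | x in [set x : 'cV[R[i]]_m | l2norm x <= 1]].

Definition blk_norm (R : realType) (k : nat) (n : 'I_k -> nat)
    (a : blockalg R n) : R :=
  \big[Num.max/0]_(j < k) opnorm (a j).

Definition strong_BJ_orthogonal (R : realType) (k : nat) (n : 'I_k -> nat)
    (a b : blockalg R n) : Prop :=
  forall c : blockalg R n, blk_norm a <= blk_norm (a + b * c).

Definition star_isomorphic (R : realType) (k l : nat)
    (n : 'I_k -> nat) (m : 'I_l -> nat) : Prop :=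
  exists f : blockalg R n -> blockalg R m,
    [/\ bijective f, linear f, {morph f : a b / a * b}
      & {morph f : a / blk_star a}].

Definition blk_perm (R : realType) (k : nat) (n : 'I_k -> nat) (pi : 'S_k)
    (pi_dim : forall j, n (pi j) = n j) (a : blockalg R n) : blockalg R n :=
  fun j => castmx (pi_dim j, pi_dim j) (a (pi j)).

(* [S] is the set of blocks on which the map is complex conjugation with
   respect to the standard basis; the map is the identity on the others. *)
Definition blk_dagger (R : realType) (k : nat) (n : 'I_k -> nat)
    (S : {set 'I_k}) (a : blockalg R n) : blockalg R n :=
  fun j => if j \in S then map_mx Num.conj (a j) else a j.

(* Main.v *)
Require Import Defs.
From mathcomp Require Import all_boot all_order all_algebra all_fingroup.
From mathcomp Require Import complex reals.
From mathcomp Require Import boolp classical_sets.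
From mathcomp Require Import ring lra.

(** Write [r a] for the product of a row [r] living on a block [i] with the
    block [a i], and call [r] a top row of [a] when [r a a^* = |a|^2 r]. Every
    [a] has a nonzero top row, and strong orthogonality is a statement about
    top rows: if some nonzero top row [r] of [a] satisfies [r b = 0], then [a]
    is orthogonal to [b] ([top_row_orthogonal]); conversely, testing the
    orthogonality against a small multiple of [- b^* a] produces a vector at
    which [a] attains its norm and whose image is killed by [b^*]
    ([orthogonal_attained]). Hence, if the top rows of [a] are the multiples of
    a single [r], then [a] is orthogonal to [b] exactly when [r b = 0]. Elements
    with this property and a prescribed [r] are easily produced
    ([peak_orthogonal]).

    Let [Phi] be additive, surjective and orthogonality preserving. Given a
    nonzero row [x], choose [a] such that the top rows of [Phi a] are the
    multiples of [x], and a top row [r] of [a]. Then [r b = 0] implies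
    [x (Phi b) = 0], so that [x (Phi b) = T (r b)] for all [b], with [T]
    additive and onto ([exists_row_pullback]). Each row of [Phi b] is therefore
    controlled by one row of [b], up to an additive map of which nothing is
    known at first. Three facts then determine [Phi].

    - The rows [r] arising from the standard rows [x] separate elements
      ([rows_separate]): otherwise [Phi] does not see some rank one element,
      which can be added with a large coefficient to a preimage of [1] so as to
      produce two orthogonal elements that are both sent to [1]. Together with
      the remark that the rows of one block come from one block, and a
      dimension count, this gives the permutation ([block_permutation]).
    - Once the permutation is removed, comparing the row of ones with the
      standard rows shows that, after rescaling the [r]'s, the same [T] serves
      all rows of a block ([common_pullback]): row [s] of [Phi a] is
      [T (row s (Y a))], with [Y] invertible.
    - Now let [Phi a] have exactly two nonzero rows [T u] and [T v], orthogonal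
      if they lie in the same block and with [T v] shorter than [T u]. Its top
      row is known, hence so is the one of [a] ([two_rows_top]); this compares
      the norms of [u] and [v] and computes their inner product. It follows
      that the rows of [Y] are orthogonal, that [T] is injective and that its
      inverse preserves orthogonality and multiplies all norms by a constant,
      the same for all blocks once the length of the rows of [Y] is factored
      out ([gauge_linear]). Being additive and norm preserving on each
      coordinate axis, the inverse of [T] is linear or conjugate linear
      ([additive_isometry]), and [Y] and [T] are unitary up to scalars.

    Conversely, the maps of the standard form multiply the norm by [gamma] and
    send right multiples to right multiples. *)

Set Implicit Arguments.
Unset Strict Implicit.
Unset Printing Implicit Defensive.

Import Order.TTheory GRing.Theory Num.Theory.
Local Open Scope ring_scope.
Local Open Scope complex_scope.
Local Open Scope sesquilinear_scope.

(** * Conjugate transposes and squared norms *)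

Section SquaredNorm.
Variable R : realType.
Local Notation C := R[i].
Implicit Types (z : C).

(** Squared moduli are taken in the real field, where the order is total. *)
Definition sqc z : R := Normc.normc z ^+ 2.

(** The squared Frobenius norm; it is only used as the squared Euclidean norm of
    rows and columns, which it treats alike. *)
Definition sqn p q (M : 'M[C]_(p, q)) : R := \sum_i \sum_j sqc (M i j).

Lemma conjE z : Num.conj z = conjc z.
Proof.
have h : (conjc z : C) = Num.conj z; last by [].
have [->|z0] := eqVneq z 0; first by rewrite conjC0 conjc0.
by apply: (mulfI z0); rewrite -sqr_normc normCK.
Qed.

Lemma sqcE z : (sqc z)%:C = z * Num.conj z.
Proof.
rewrite -normCK normc_def /sqc -rmorphXn /=; congr (_ %:C).
by case: z.
Qed.

Lemma sqc_ge0 z : 0 <= sqc z.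
Proof. exact: sqr_ge0. Qed.

Lemma sqc_eq0 z : (sqc z == 0) = (z == 0).
Proof.
by rewrite -(inj_eq (@complexI R)) sqcE mulf_eq0 conjC_eq0 orbb.
Qed.

Lemma sqcM z z' : sqc (z * z') = sqc z * sqc z'.
Proof. by apply: complexI; rewrite [RHS]rmorphM /= !sqcE rmorphM mulrACA. Qed.

Lemma sqcJ z : sqc (Num.conj z) = sqc z.
Proof. by apply: complexI; rewrite !sqcE conjCK mulrC. Qed.

Lemma sqc1 : sqc 1 = 1.
Proof. by rewrite /sqc Normc.normc1 expr1n. Qed.

Lemma sqcR (x : R) : sqc x%:C = x ^+ 2.
Proof. by apply: complexI; rewrite sqcE conjE conjc_real rmorphXn. Qed.

Lemma ctmxM p q r (A : 'M[C]_(p, q)) (B : 'M[C]_(q, r)) :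
  (A *m B)^t* = B^t* *m A^t*.
Proof. by rewrite trmx_mul map_mxM. Qed.

Lemma ctmxD p q (A B : 'M[C]_(p, q)) : (A + B)^t* = A^t* + B^t*.
Proof. by rewrite linearD /= map_mxD. Qed.

Lemma ctmxN p q (A : 'M[C]_(p, q)) : (- A)^t* = - A^t*.
Proof. by rewrite linearN /= map_mxN. Qed.

Lemma ctmxZ p q z (A : 'M[C]_(p, q)) : (z *: A)^t* = Num.conj z *: A^t*.
Proof. by rewrite linearZ /= map_mxZ. Qed.

Lemma ctmx0 p q : (0 : 'M[C]_(p, q))^t* = 0.
Proof. by rewrite trmx0 map_mx0. Qed.

Lemma ctmx1 p : (1%:M : 'M[C]_p)^t* = 1%:M.
Proof. by rewrite trmx1 map_mx1. Qed.

Lemma sqnE p q (M : 'M[C]_(p, q)) : (sqn M)%:C = \tr (M *m M^t*).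
Proof.
rewrite /sqn rmorph_sum /mxtrace; apply: eq_bigr => i _.
by rewrite rmorph_sum !mxE; apply: eq_bigr => j _; rewrite !mxE -sqcE.
Qed.

Lemma sqn_ge0 p q (M : 'M[C]_(p, q)) : 0 <= sqn M.
Proof. by apply: sumr_ge0 => i _; apply: sumr_ge0 => j _; exact: sqc_ge0. Qed.

Lemma sqn_eq0 p q (M : 'M[C]_(p, q)) : (sqn M == 0) = (M == 0).
Proof.
apply/idP/eqP => [|->]; last first.
  by apply/eqP; apply: complexI; rewrite sqnE mul0mx mxtrace0.
rewrite psumr_eq0 => [/allP h|i _]; last first.
  by apply: sumr_ge0 => j _; exact: sqc_ge0.
apply/matrixP => i j; rewrite mxE; apply/eqP; rewrite -sqc_eq0.
have /= := h i (mem_index_enum i).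
rewrite psumr_eq0 => [/allP/(_ j (mem_index_enum j))//|k _].
exact: sqc_ge0.
Qed.

Lemma sqn_gt0 p q (M : 'M[C]_(p, q)) : (0 < sqn M) = (M != 0).
Proof. by rewrite lt_def sqn_ge0 andbT sqn_eq0. Qed.

Lemma sqnZ p q z (M : 'M[C]_(p, q)) : sqn (z *: M) = sqc z * sqn M.
Proof.
apply: complexI; rewrite [RHS]rmorphM /= !sqnE sqcE ctmxZ.
by rewrite -scalemxAl -scalemxAr scalerA mxtraceZ.
Qed.

Lemma sqnMn p q (M : 'M[C]_(p, q)) (l : nat) : sqn (M *+ l) = l%:R ^+ 2 * sqn M.
Proof. by rewrite -scaler_nat sqnZ -sqcR rmorph_nat. Qed.

Lemma sqn0 p q : sqn (0 : 'M[C]_(p, q)) = 0.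
Proof. by apply/eqP; rewrite sqn_eq0. Qed.

Lemma sqn_ctmx p q (M : 'M[C]_(p, q)) : sqn (M^t*) = sqn M.
Proof. by apply: complexI; rewrite !sqnE trmxCK mxtrace_mulC. Qed.

Lemma sqnD p q (M N : 'M[C]_(p, q)) :
  sqn (M + N) = sqn M + sqn N + 2 * complex.Re (\tr (M^t* *m N)).
Proof.
have trJ (X : 'M[C]_(p, q)) (Y : 'M[C]_(p, q)) :
    \tr (X *m Y^t*) = conjc (\tr (X^t* *m Y)).
  rewrite -conjE [in RHS]mxtrace_mulC -(trmxK (Y *m _)) mxtrace_tr.
  rewrite -{1}[X]trmxCK -ctmxM.
  rewrite /mxtrace rmorph_sum; apply: eq_bigr => i _.
  by rewrite [LHS]mxE; congr (Num.conj _); rewrite !mxE; apply: eq_bigr => k _;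
     rewrite !mxE mulrC.
apply: complexI; rewrite !(rmorphD, rmorphM) /= !sqnE ctmxD mulmxDl !mulmxDr.
rewrite !mxtraceD (trJ M N) (mxtrace_mulC N).
have := addcJ (\tr (M^t* *m N)); set t := \tr (M^t* *m N) => h.
have -> : 1%:C + 1%:C = 2 :> C by [].
by rewrite -h; ring.
Qed.

Lemma sqnD_orth p q (M N : 'M[C]_(p, q)) :
  M^t* *m N = 0 -> sqn (M + N) = sqn M + sqn N.
Proof. by move=> h; rewrite sqnD h mxtrace0 /= mulr0 addr0. Qed.

Lemma mulmx_tr1 (M : 'M[C]_1) : M = (\tr M)%:M.
Proof. by rewrite [LHS]mx11_scalar /mxtrace big_ord1. Qed.

Lemma row_sqn q (r : 'rV[C]_q) : r *m r^t* = (sqn r)%:C%:M.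
Proof. by rewrite sqnE -mulmx_tr1. Qed.

Lemma col_sqn q (x : 'cV[C]_q) : x^t* *m x = (sqn x)%:C%:M.
Proof. by rewrite -sqn_ctmx -row_sqn trmxCK. Qed.

Lemma sqn_unitl p q (U : 'M[C]_p) (M : 'M[C]_(p, q)) :
  U^t* *m U = 1%:M -> sqn (U *m M) = sqn M.
Proof.
move=> h; rewrite -(sqn_ctmx M) -(sqn_ctmx (U *m M)); apply: complexI.
by rewrite !sqnE !trmxCK ctmxM mulmxA -(mulmxA _ (U^t*)) h mulmx1.
Qed.

Lemma ctmx_delta p q (i : 'I_p) (j : 'I_q) :
  (delta_mx i j : 'M[C]_(p, q))^t* = delta_mx j i.
Proof. by rewrite trmx_delta map_delta_mx. Qed.

Lemma row_delta_col p (s l : 'I_p) :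
  row l (delta_mx s 0 : 'cV[C]_p) = (l == s)%:R%:M.
Proof. by apply/matrixP => i j; rewrite !ord1 !mxE eqxx mulr1n andbT. Qed.

Lemma sqn_delta p q (i : 'I_p) (j : 'I_q) : sqn (delta_mx i j : 'M[C]_(p, q)) = 1.
Proof.
apply: complexI; rewrite sqnE ctmx_delta mul_delta_mx /mxtrace (bigD1 i) //=.
by rewrite big1 ?addr0 => [|l /negbTE li]; rewrite mxE ?eqxx ?li.
Qed.

Lemma l2normE m (x : 'cV[C]_m) : l2norm x = Num.sqrt (sqn x).
Proof.
congr (Num.sqrt _); apply: eq_bigr => i _.
by rewrite big_ord1.
Qed.

(** * The norm is attained *)

(** In an orthonormal eigenbasis of [M^* M] the squared norm of [M z] is an
    average, weighted by the squared coordinates of [z], of its values at the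
    eigenvectors, so that the largest of these values is the maximum. This avoids
    any compactness argument. *)
Lemma spectral_attained m (M : 'M[C]_m) : (0 < m)%N ->
  exists2 x : 'cV[C]_m, sqn x = 1 &
    forall z : 'cV[C]_m, sqn (M *m z) <= sqn (M *m x) * sqn z.
Proof.
move=> m_gt0.
pose A := M^t* *m M.
have A_normal : A \is normalmx.
  by apply/normalmxP; rewrite /A ctmxM trmxCK.
have /orthomx_spectralP := A_normal.
set P := spectralmx A; set d := spectral_diag A.
have Pu : P \is unitarymx := spectral_unitarymx A.
rewrite (invmx_unitary Pu) => AE.
have PPt : P *m P^t* = 1%:M by exact/unitarymxP.
have PtP : P^t* *m P = 1%:M by exact: mulmx1C.
pose c k : 'cV[C]_m := (row k P)^t*.
have sqM (z : 'cV[C]_m) :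
    (sqn (M *m z))%:C = \sum_k d 0 k * (sqc ((P *m z) k 0))%:C.
  rewrite -sqn_ctmx sqnE trmxCK ctmxM -mulmxA (mulmxA (M^t*)) -/A AE.
  rewrite !mulmxA -!mulmxA (mulmxA (z^t*)) -ctmxM /mxtrace big_ord1 mxE.
  apply: eq_bigr => k _; rewrite mul_diag_mx.
  by move: (P *m z) => w; rewrite !mxE sqcE mulrCA [X in _ = _ * X]mulrC.
have Pc k : P *m c k = delta_mx k 0.
  apply/matrixP => i j; rewrite ord1 !mxE andbT.
  have := congr1 (fun X : 'M[C]_m => X i k) PPt; rewrite !mxE => <-.
  by apply: eq_bigr => l _; rewrite !mxE.
have dE k : d 0 k = (sqn (M *m c k))%:C.
  rewrite sqM Pc (bigD1 k) //= big1 ?addr0 => [|l lk]; last first.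
    by rewrite mxE (negbTE lk) /= sqcE mul0r mulr0.
  by rewrite mxE !eqxx sqcE conjC1 !mulr1.
pose k0 : 'I_m := Ordinal m_gt0.
pose k := [arg max_(l > k0) sqn (M *m c l)]%O.
have kP l : sqn (M *m c l) <= sqn (M *m c k).
  by rewrite /k; case: arg_maxP => // i _; apply.
exists (c k).
  by rewrite -(sqn_unitl _ PtP) Pc sqn_delta.
move=> z.
have -> : sqn (M *m z) = \sum_l sqn (M *m c l) * sqc ((P *m z) l 0).
  apply: complexI; rewrite sqM rmorph_sum; apply: eq_bigr => l _.
  by rewrite dE -rmorphM.
have -> : sqn z = \sum_l sqc ((P *m z) l 0).
  have <- : sqn (P *m z) = sqn z by exact: sqn_unitl.
  by apply: eq_bigr => l _; rewrite big_ord1.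
rewrite big_distrr /=; apply: ler_sum => l _.
by rewrite ler_wpM2r ?sqc_ge0.
Qed.

Lemma opnorm_attained m (M : 'M[C]_m) : (0 < m)%N ->
  exists x : 'cV[C]_m, [/\ sqn x = 1, opnorm M = Num.sqrt (sqn (M *m x)) &
    forall z : 'cV[C]_m, sqn (M *m z) <= opnorm M ^+ 2 * sqn z].
Proof.
move=> /(spectral_attained M)[x x1 xP]; exists x.
suff e : opnorm M = Num.sqrt (sqn (M *m x)) by rewrite e sqr_sqrtr ?sqn_ge0.
rewrite /opnorm; set E := (X in sup X).
have xE : E (Num.sqrt (sqn (M *m x))).
  by exists x => /=; rewrite l2normE ?x1 ?sqrtr1.
have ubE : ubound E (Num.sqrt (sqn (M *m x))).
  move=> _ [z /= z1 <-]; rewrite l2normE ler_wsqrtr // (le_trans (xP z)) //.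
  rewrite ler_piMr ?sqn_ge0 //.
  by move: z1; rewrite l2normE -{1}sqrtr1 ler_sqrt.
apply/eqP; rewrite eq_le ge_sup //=; last by exists (Num.sqrt (sqn (M *m x))).
by apply: ub_le_sup => //; exists (Num.sqrt (sqn (M *m x))).
Qed.

(** A matrix and its adjoint have the same norm. Expanding
    [|M w - mu r^*|^2 >= 0] at [w = (r M)^*] replaces the usual appeal to the
    Cauchy-Schwarz inequality, which is then the case of a single column. *)
Lemma sqn_row_bound p q (M : 'M[C]_(p, q)) (mu : R) : 0 <= mu ->
  (forall z : 'cV[C]_q, sqn (M *m z) <= mu * sqn z) ->
  forall r : 'rV[C]_p, sqn (r *m M) <= mu * sqn r.
Proof.
move=> mu_ge0 bM r.
pose w := (r *m M)^t*.
have nw : sqn (r *m M) = sqn w by rewrite sqn_ctmx.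
rewrite nw; have bw := bM w.
have [mu0|mu_neq0] := eqVneq mu 0.
  have Mw0 : M *m w = 0.
    by apply/eqP; rewrite -sqn_eq0 eq_le sqn_ge0 andbT -(mul0r (sqn w)) -mu0.
  suff -> : sqn w = 0 by rewrite mu0 mul0r.
  apply: complexI; rewrite -nw sqnE -/w -mulmxA Mw0 mulmx0 mxtrace0.
  by [].
have mu_gt0 : 0 < mu by rewrite lt_def mu_neq0.
have := sqn_ge0 (M *m w + - mu%:C *: r^t*).
have tE : \tr ((M *m w)^t* *m (- mu%:C *: r^t*)) = (- (mu * sqn w))%:C.
  rewrite -scalemxAr mxtraceZ ctmxM -mulmxA -ctmxM mxtrace_mulC -sqnE.
  by rewrite mulNr -rmorphM -rmorphN.
rewrite sqnD tE sqnZ sqn_ctmx -rmorphN sqcR sqrrN /= => h.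
rewrite -(ler_pM2l mu_gt0); nra.
Qed.

Lemma sqn11 (M : 'M[C]_1) : sqn M = sqc (M 0 0).
Proof. by rewrite /sqn !big_ord1. Qed.

Lemma sqn_mul_scalar p (z : 'cV[C]_p) (y : 'M[C]_1) : sqn (z *m y) = sqn z * sqn y.
Proof. by rewrite sqn11 {1}[y]mx11_scalar mul_mx_scalar sqnZ mulrC. Qed.

Lemma cauchy_schwarz p (r : 'rV[C]_p) (z : 'cV[C]_p) :
  sqn (r *m z) <= sqn r * sqn z.
Proof.
rewrite mulrC; apply: sqn_row_bound => [|y]; first exact: sqn_ge0.
by rewrite sqn_mul_scalar.
Qed.

Variables (k : nat) (n : 'I_k -> nat).
Local Notation A := (blockalg R n).
Implicit Types (a b c : A).

Lemma blk_norm_ge0 a : 0 <= blk_norm a.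
Proof.
rewrite /blk_norm; elim/big_rec: _ => // j x _ x_ge0.
by rewrite le_max x_ge0 orbT.
Qed.

Lemma blk_norm_bound a j (z : 'cV[C]_(n j)) : 
  sqn (a j *m z) <= blk_norm a ^+ 2 * sqn z.
Proof.
have [n0|n_gt0] := posnP (n j).
  have -> : z = 0 by apply/matrixP => i; have := ltn_ord i; rewrite {2}n0.
  by rewrite mulmx0 sqn0 mulr0.
have [x [x1 e b]] := opnorm_attained (a j) n_gt0.
apply: (le_trans (b z)); rewrite ler_wpM2r ?sqn_ge0 // lerXn2r ?nnegrE //.
- by rewrite e sqrtr_ge0.
- exact: blk_norm_ge0.
- by rewrite /blk_norm; apply: le_bigmax.
Qed.

Lemma blk_norm_row_bound a j (r : 'rV[C]_(n j)) : 
  sqn (r *m a j) <= blk_norm a ^+ 2 * sqn r.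
Proof.
apply: sqn_row_bound; first exact: sqr_ge0.
exact: blk_norm_bound.
Qed.

Lemma blk_norm_attained a : (0 < k)%N -> (forall j, (0 < n j)%N) ->
  exists j (x : 'cV[C]_(n j)), sqn x = 1 /\ sqn (a j *m x) = blk_norm a ^+ 2.
Proof.
move=> k_gt0 n_gt0.
have aj j : {x : 'cV[C]_(n j) | sqn x = 1 /\ opnorm (a j) = Num.sqrt (sqn (a j *m x))}.
  by apply: cid; have [x [? ? _]] := opnorm_attained (a j) (n_gt0 j); exists x.
have [j _ e] : {j | j \in predT & blk_norm a = opnorm (a j)}.
  apply: (@Order.TotalTheory.eq_bigmax _ _ _ 0 (Ordinal k_gt0)) => // j _.
  by have [x [_ ->]] := aj j; exact: sqrtr_ge0.
have [x [x1 xE]] := aj j; exists j, x.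
by split=> //; rewrite e xE sqr_sqrtr ?sqn_ge0.
Qed.


(** * Top rows and strong orthogonality *)

(** For [a] nonzero, the top rows are the adjoints of the vectors [a x], where [a]
    attains its norm at [x]. *)
Definition top_row a j (r : 'rV[C]_(n j)) : Prop :=
  r *m a j *m (a j)^t* = (blk_norm a ^+ 2)%:C *: r.

Lemma top_row_sqn a j (r : 'rV[C]_(n j)) :
  top_row a r -> sqn (r *m a j) = blk_norm a ^+ 2 * sqn r.
Proof.
move=> h; apply: complexI; rewrite rmorphM /= !sqnE ctmxM mulmxA h.
by rewrite -scalemxAl mxtraceZ.
Qed.

(** [|a^* a x - |a|^2 x|^2 <= 0] as soon as [a] attains its norm at [x]. *)
Lemma attained_top_row a j (x : 'cV[C]_(n j)) :
  sqn (a j *m x) = blk_norm a ^+ 2 * sqn x -> top_row a ((a j *m x)^t*).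
Proof.
set mu := blk_norm a ^+ 2 => xE; set M := a j.
have mu_ge0 : 0 <= mu by exact: sqr_ge0.
suff e : M^t* *m (M *m x) = mu%:C *: x.
  have := congr1 (fun X : 'cV_(n j) => (M *m X)^t*) e.
  by rewrite (ctmxM M) (ctmxM (M^t*)) trmxCK -scalemxAr ctmxZ conjE conjc_real.
have le1 : sqn (M^t* *m (M *m x)) <= mu * sqn (M *m x).
  rewrite -sqn_ctmx ctmxM trmxCK -(sqn_ctmx (M *m x)).
  exact: blk_norm_row_bound.
apply/eqP; rewrite -subr_eq0 -sqn_eq0 eq_le sqn_ge0 andbT.
have tE : \tr ((M^t* *m (M *m x))^t* *m (- mu%:C *: x)) =
    (- (mu * sqn (M *m x)))%:C.
  rewrite -scalemxAr mxtraceZ ctmxM trmxCK -mulmxA mxtrace_mulC -sqnE.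
  by rewrite mulNr -rmorphM -rmorphN.
rewrite -scaleNr sqnD tE sqnZ -rmorphN sqcR sqrrN /=.
by rewrite xE in le1 *; nra.
Qed.

(** When [a = 0] the image of a maximizing vector vanishes, but every row is
    then a top row. *)
Lemma exists_top_row a : (0 < k)%N -> (forall j, (0 < n j)%N) ->
  exists j (r : 'rV[C]_(n j)), r != 0 /\ top_row a r.
Proof.
move=> k_gt0 n_gt0.
have [j [x [x1 xE]]] := blk_norm_attained a k_gt0 n_gt0.
have [a0|a_neq0] := eqVneq (blk_norm a) 0; last first.
  exists j, ((a j *m x)^t*); split; last by apply: attained_top_row; rewrite x1 mulr1.
  by rewrite -sqn_eq0 sqn_ctmx xE sqrf_eq0.
exists j, (delta_mx 0 (Ordinal (n_gt0 j))); split.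
  by rewrite -sqn_eq0 sqn_delta oner_eq0.
rewrite /top_row a0 expr0n /= scale0r.
suff -> : (delta_mx 0 (Ordinal (n_gt0 j)) : 'rV[C]_(n j)) *m a j = 0 by rewrite mul0mx.
apply/eqP; rewrite -sqn_eq0 eq_le sqn_ge0 andbT.
by apply: (le_trans (blk_norm_row_bound _ _)); rewrite a0 expr0n mul0r.
Qed.

(** Right multiples of [b] do not change [r a], whose length already witnesses the
    norm of [a]. *)
Lemma top_row_orthogonal a b j (r : 'rV[C]_(n j)) :
  r != 0 -> top_row a r -> r *m b j = 0 -> strong_BJ_orthogonal a b.
Proof.
move=> r0 ra rb c.
have := blk_norm_row_bound (a + b * c) r.
have -> : r *m (a + b * c) j = r *m a j.
  by rewrite mulmxDr mulmxA rb mul0mx addr0.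
rewrite (top_row_sqn ra) ler_pM2r ?sqn_gt0 //.
by rewrite ler_sqr ?nnegrE ?blk_norm_ge0.
Qed.

Lemma orthogonal_attained_aux (v s w x y : R) :
  v + s + 2 * - w = x -> y <= x -> v <= y -> s <= w -> 0 <= w ->
  v = y /\ w = 0.
Proof. by move=> *; split; lra. Qed.

(** Let [P = b b^*]. For small [t] and unit [x], the squared norm of
    [(1 - t P) a x] is at most [|a x|^2 - t |b^* a x|^2]. Orthogonality makes it
    at least [|a|^2] for some [x], so that nothing is lost at this [x]. *)
Lemma orthogonal_attained a b : (0 < k)%N -> (forall j, (0 < n j)%N) ->
  strong_BJ_orthogonal a b ->
  exists j (x : 'cV[C]_(n j)), [/\ sqn x = 1, sqn (a j *m x) = blk_norm a ^+ 2
    & (b j)^t* *m (a j *m x) = 0].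
Proof.
move=> k_gt0 n_gt0 ab.
(* small enough for the quadratic term in t to be at most half of the linear one *)
pose t := (1 + blk_norm b ^+ 2)^-1.
have b2 := sqr_ge0 (blk_norm b).
have t_gt0 : 0 < t by rewrite invr_gt0; lra.
have tb : t * (1 + blk_norm b ^+ 2) = 1 by rewrite mulVf //; lra.
pose c : A := fun j => (- t)%:C *: ((b j)^t* *m a j).
have [j [x [x1 xE]]] := blk_norm_attained (a + b * c) k_gt0 n_gt0.
set v := a j *m x; pose w := (b j)^t* *m v.
have vE : (a + b * c) j *m x = v + (- t)%:C *: (b j *m w).
  by rewrite mulmxDl -!mulmxA -!scalemxAl -!scalemxAr -!mulmxA.
have tE : \tr (v^t* *m ((- t)%:C *: (b j *m w))) = (- (t * sqn w))%:C.
  rewrite -scalemxAr mxtraceZ mulmxA -[b j in LHS]trmxCK -ctmxM.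
  by rewrite mxtrace_mulC -sqnE -rmorphM mulNr.
have le1 : blk_norm a ^+ 2 <= blk_norm (a + b * c) ^+ 2.
  by rewrite ler_sqr ?nnegrE ?blk_norm_ge0 //; exact: ab.
have le2 := blk_norm_bound a x.
have le3 := blk_norm_bound b w.
move: xE; rewrite vE sqnD tE sqnZ sqcR sqrrN /= => xE.
rewrite -/v x1 mulr1 in le2.
have w0 := sqn_ge0 w.
have bw : t ^+ 2 * sqn (b j *m w) <= t * sqn w.
  have -> : t * sqn w = t ^+ 2 * ((1 + blk_norm b ^+ 2) * sqn w).
    by rewrite expr2 -mulrA (mulrA t (1 + _)) tb mul1r.
  by rewrite ler_pM2l ?exprn_gt0 // mulrDl mul1r (le_trans le3) // lerDr.
have tw : 0 <= t * sqn w by rewrite mulr_ge0 // ltW.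
have [vE' tw0] := orthogonal_attained_aux xE le1 le2 bw tw.
exists j, x; split=> //.
by move/eqP: tw0; rewrite mulf_eq0 (gt_eqF t_gt0) /= sqn_eq0 => /eqP.
Qed.

End SquaredNorm.

(** * Elements with a prescribed top row *)

Section Peak.
Variables (R : realType) (k : nat) (n : 'I_k -> nat).
Local Notation C := R[i].
Local Notation A := (blockalg R n).
Implicit Types (a b c : A).

Lemma blkP a b : (forall j, a j = b j) -> a = b.
Proof. by move=> h; apply: functional_extensionality_dep => j; exact: h. Qed.

Lemma blk_addE a b j : (a + b) j = a j + b j.
Proof. by []. Qed.

Lemma blk_subE a b j : (a - b) j = a j - b j.
Proof. by []. Qed.

Lemma blk_mulE a b j : (a * b) j = a j *m b j.
Proof. by []. Qed.

Lemma blk0E j : (0 : A) j = 0.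
Proof. by []. Qed.

Definition blk_in j (M : 'M[C]_(n j)) : A := fun i =>
  if j =P i is ReflectT e then castmx (congr1 n e, congr1 n e) M else 0.

Lemma blk_in_same j (M : 'M[C]_(n j)) : blk_in M j = M.
Proof.
rewrite /blk_in; case: eqP => // e.
by rewrite (eq_irrelevance e erefl) castmx_id.
Qed.

Lemma blk_in_other j (M : 'M[C]_(n j)) i : i != j -> blk_in M i = 0.
Proof.
by move=> ij; rewrite /blk_in; case: eqP => // e; rewrite e eqxx in ij.
Qed.

Lemma blk_in0 j : blk_in (0 : 'M[C]_(n j)) = 0.
Proof.
apply: blkP => i; have [ij|ij] := eqVneq i j; last by rewrite blk_in_other.
by subst i; rewrite blk_in_same.
Qed.

(** The sum of a rank one element [w x] of the block [j] and of an element [t]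
    acting orthogonally to it, both on the left and on the right. If [t] is not
    larger than [w x], the norm is that of [w x] and [w^*] is a top row; if [t] is
    smaller, the top rows are the multiples of [w^*]. *)
Section PeakLemma.
Variables (j : 'I_k) (w : 'cV[C]_(n j)) (x : 'rV[C]_(n j)) (t : A) (tau : R).
Hypothesis x0 : x != 0.
Hypotheses (wt : w^t* *m t j = 0) (tx : t j *m x^t* = 0).
Hypothesis tb : forall i (z : 'cV[C]_(n i)), sqn (t i *m z) <= tau * sqn z.

Local Notation a := (blk_in (w *m x) + t).
Local Notation m := (sqn w * sqn x).

Lemma peak_other i : i != j -> a i = t i.
Proof. by move=> ij; rewrite -[LHS]/(_ + _) blk_in_other // add0r. Qed.

Lemma peak_same : a j = w *m x + t j.
Proof. by rewrite -[LHS]/(_ + _) blk_in_same. Qed.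

Let x_gt0 : 0 < sqn x. Proof. by rewrite sqn_gt0. Qed.

(** Along [x^*] only [w x] acts, and on its orthogonal complement only [t]. *)
Lemma peak_split (z : 'cV[C]_(n j)) : exists (al : C) (z2 : 'cV[C]_(n j)),
  [/\ z = al *: x^t* + z2, sqn z = sqc al * sqn x + sqn z2
    & sqn (a j *m z) = m * (sqc al * sqn x) + sqn (t j *m z2)].
Proof.
pose al := (x *m z) 0 0 / (sqn x)%:C; pose z2 := z - al *: x^t*.
have zE : z = al *: x^t* + z2 by rewrite /z2 addrCA subrr addr0.
have xz2 : x *m z2 = 0.
  rewrite /z2 mulmxBr -scalemxAr row_sqn [x *m z]mx11_scalar.
  apply/matrixP => i i'; rewrite !ord1 !mxE eqxx !mulr1n /al.
  rewrite mulfVK ?fmorph_eq0 ?gt_eqF //; first by rewrite !mxE subrr.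
have o1 : (al *: x^t*)^t* *m z2 = 0.
  by rewrite ctmxZ trmxCK -scalemxAl xz2 scaler0.
exists al, z2; split=> //.
  by rewrite {1}zE sqnD_orth // sqnZ sqn_ctmx.
rewrite {1}zE peak_same mulmxDr mulmxDl -scalemxAr (mulmxDl _ _ z2).
rewrite -[w *m x *m z2]mulmxA xz2 mulmx0 add0r -mulmxA row_sqn.
rewrite -scalemxAr tx scaler0 mul_mx_scalar addr0 scalerA sqnD_orth.
  by rewrite sqnZ sqcM sqcR; congr (_ + _); ring.
by rewrite ctmxZ -scalemxAl mulmxA wt mul0mx scaler0.
Qed.

Lemma peak_bound : tau <= m -> forall i (z : 'cV[C]_(n i)),
  sqn (a i *m z) <= m * sqn z.
Proof.
move=> tau_m i z; have [ij|ij] := eqVneq i j; last first.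
  rewrite peak_other // (le_trans (tb z)) // ler_wpM2r ?sqn_ge0 //.
move: z; rewrite {}ij => z.
have [al [z2 [_ -> ->]]] := peak_split z.
rewrite mulrDr lerD2l (le_trans (tb z2)) // ler_wpM2r ?sqn_ge0 //.
Qed.

Lemma peak_norm : (forall j, 0 < n j)%N -> tau <= m -> blk_norm a ^+ 2 = m.
Proof.
move=> n_gt0 tau_m; have k_gt0 := leq_ltn_trans (leq0n j) (ltn_ord j).
apply/eqP; rewrite eq_le; apply/andP; split.
  have [i [z [z1 <-]]] := blk_norm_attained a k_gt0 n_gt0.
  by rewrite (le_trans (peak_bound tau_m z)) // z1 mulr1.
have := blk_norm_bound a (x^t*).
rewrite peak_same mulmxDl tx addr0 -mulmxA row_sqn mul_mx_scalar sqnZ sqcR.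
by rewrite sqn_ctmx [sqn x ^+ 2]expr2 -mulrA [leLHS]mulrC ler_pM2r // mulrC.
Qed.

Lemma peak_top_row : (forall j, 0 < n j)%N -> tau <= m -> top_row a (w^t*).
Proof.
move=> n_gt0 tau_m; rewrite /top_row peak_norm // peak_same.
rewrite mulmxDr wt addr0 mulmxA col_sqn mul_scalar_mx -scalemxAl.
rewrite ctmxD mulmxDr ctmxM mulmxA row_sqn mul_scalar_mx.
have -> : x *m (t j)^t* = 0 by rewrite -[LHS]trmxCK ctmxM trmxCK tx ctmx0.
by rewrite addr0 scalerA -rmorphM.
Qed.

(** A vector where the norm is attained must be a multiple of [x^*], whose image
    is a multiple of [w]. *)
Lemma peak_orthogonal b : (forall j, 0 < n j)%N -> tau < m ->
  strong_BJ_orthogonal a b -> w^t* *m b j = 0.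
Proof.
move=> n_gt0 tau_m ab; have k_gt0 := leq_ltn_trans (leq0n j) (ltn_ord j).
have [i [z [z1]]] := orthogonal_attained k_gt0 n_gt0 ab.
rewrite peak_norm ?(ltW tau_m) //.
have [ij|ij] := eqVneq i j; last first.
  rewrite peak_other // => e; have := tb z; rewrite z1 mulr1 e.
  by rewrite leNgt tau_m.
move: z z1; rewrite {}ij => z z1.
have [al [z2 [zE nz ->]]] := peak_split z.
have h := tb z2; move=> e; rewrite z1 in nz.
have z20 : z2 = 0.
  have s2 := sqn_ge0 z2.
  apply/eqP; rewrite -sqn_eq0; apply/eqP.
  move: e h nz s2 tau_m; clear.
  move: (sqn z2) (sqn (_ *m _)) (sqn w * _) (sqc al * _) => s u M v e h nz s2 tau_m.
  nra.
rewrite zE z20 addr0 peak_same -scalemxAr mulmxDl tx addr0 -mulmxA row_sqn.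
rewrite mul_mx_scalar -!scalemxAr => /eqP; rewrite !scaler_eq0.
have -> : (sqn x)%:C == 0 = false.
  by rewrite fmorph_eq0 gt_eqF.
have -> : (al == 0) = false.
  apply/eqP => al0; move: nz; rewrite al0 z20 sqn0 /sqc Normc.normc0 expr0n mul0r addr0.
  by move/eqP; rewrite oner_eq0.
by move=> /eqP bw; rewrite -[LHS]trmxCK ctmxM trmxCK bw ctmx0.
Qed.
End PeakLemma.
End Peak.

(** * Maps of the standard form preserve orthogonality *)

Section Standard.
Variables (R : realType) (k : nat) (n : 'I_k -> nat).
Hypotheses (k_gt0 : (0 < k)%N) (n_gt0 : forall j, (0 < n j)%N).
Local Notation C := R[i].
Local Notation A := (blockalg R n).
Implicit Types (a b c : A).

Lemma blk_norm_le a (nu : R) : 0 <= nu ->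
  (forall j (z : 'cV[C]_(n j)), sqn (a j *m z) <= nu ^+ 2 * sqn z) ->
  blk_norm a <= nu.
Proof.
move=> nu_ge0 h; have [j [x [x1 xE]]] := blk_norm_attained a k_gt0 n_gt0.
rewrite -ler_sqr ?nnegrE ?blk_norm_ge0 // -xE.
by rewrite (le_trans (h j x)) // x1 mulr1.
Qed.

Lemma blk_cast a i j (ij : i = j) (e : n i = n j) : castmx (e, e) (a i) = a j.
Proof. by case: j / ij e => e; rewrite (eq_irrelevance e erefl) castmx_id. Qed.

Lemma sqn_castmx m m' (e : m = m') (M : 'M[C]_m) (z : 'cV[C]_m') :
  sqn (castmx (e, e) M *m z) = sqn (M *m castmx (esym e, erefl) z) /\
  sqn (castmx (esym e, erefl) z) = sqn z.
Proof. by case: m' / e z => z; rewrite !castmx_id. Qed.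

Definition cjif p q (s : bool) (M : 'M[C]_(p, q)) := if s then map_mx Num.conj M else M.

Lemma cjifK p q s : involutive (@cjif p q s).
Proof.
by case: s => M //=; apply/matrixP => i j; rewrite !mxE conjCK.
Qed.

Lemma cjifM p q r s (M : 'M[C]_(p, q)) (N : 'M[C]_(q, r)) :
  cjif s (M *m N) = cjif s M *m cjif s N.
Proof. by case: s => //=; rewrite map_mxM. Qed.

Lemma cjif_row p q s (M : 'M[C]_(p, q)) i : row i (cjif s M) = cjif s (row i M).
Proof. by case: s => //=; rewrite map_row. Qed.

Lemma sqn_cjif p q s (M : 'M[C]_(p, q)) : sqn (cjif s M) = sqn M.
Proof.
case: s => //=; apply: eq_bigr => i _; apply: eq_bigr => j _.
by rewrite mxE sqcJ.
Qed.

Variables (pi : 'S_k) (pi_dim : forall j, n (pi j) = n j) (S : {set 'I_k}).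

Definition blk_twist a : A := blk_dagger S (blk_perm pi_dim a).

Lemma blk_twistE a j :
  blk_twist a j = cjif (j \in S) (castmx (pi_dim j, pi_dim j) (a (pi j))).
Proof. by []. Qed.

Lemma blk_twistD : {morph blk_twist : a b / a + b}.
Proof.
move=> a b; apply: blkP => j; rewrite -[RHS]/(_ + _) !blk_twistE.
rewrite -[(a + b) _]/(_ + _).
move: (pi_dim j) (a _) (b _) => e; case: _ / e => M N.
by rewrite !castmx_id /cjif; case: ifP => // _; rewrite map_mxD.
Qed.

Lemma blk_twistM : {morph blk_twist : a b / a * b}.
Proof.
move=> a b; apply: blkP => j; rewrite -[RHS]/(_ *m _) !blk_twistE.
rewrite -cjifM; congr cjif; rewrite -[(a * b) _]/(_ *m _).
move: (pi_dim j) (a _) (b _) => e; case: _ / e => M N.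
by rewrite !castmx_id.
Qed.

Lemma blk_twist_surj b : exists a, blk_twist a = b.
Proof.
have e i : n (pi^-1%g i) = n i by rewrite -[in RHS](permKV pi i) pi_dim.
pose d : A := fun j => cjif (j \in S) (b j).
exists (fun i => castmx (e i, e i) (d (pi^-1%g i))); apply: blkP => j.
rewrite blk_twistE castmx_comp /= blk_cast ?permK //.
by rewrite /d cjifK.
Qed.

Variables (gamma : R) (u v : A).
Hypotheses (gamma_gt0 : 0 < gamma) (uu : blk_unitary u) (vu : blk_unitary v).

Definition blk_standard a : A := gamma%:C *: (u * blk_twist a * v).

Let uuj j : (u j)^t* *m u j = 1%:M.
Proof. exact: (congr1 (fun a : A => a j) uu.1). Qed.

Let vvj j : (v j)^t* *m v j = 1%:M.
Proof. exact: (congr1 (fun a : A => a j) vu.1). Qed.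

Let vvj' j : v j *m (v j)^t* = 1%:M.
Proof. exact: (congr1 (fun a : A => a j) vu.2). Qed.

Lemma sqn_standard a j (z : 'cV[C]_(n j)) :
  let z' := castmx (esym (pi_dim j), erefl) (cjif (j \in S) (v j *m z)) in
  sqn (blk_standard a j *m z) = gamma ^+ 2 * sqn (a (pi j) *m z') /\
  sqn z' = sqn z.
Proof.
rewrite -[blk_standard a j]/(_ *: (u j *m blk_twist a j *m v j)).
rewrite -scalemxAl sqnZ sqcR -!mulmxA sqn_unitl // blk_twistE.
have [h nz] := sqn_castmx (pi_dim j) (a (pi j)) (cjif (j \in S) (v j *m z)).
rewrite /= nz -h; split; last by rewrite sqn_cjif sqn_unitl.
by rewrite -[in RHS](sqn_cjif (j \in S)) cjifM cjifK.
Qed.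

Lemma blk_norm_standard a : blk_norm (blk_standard a) = gamma * blk_norm a.
Proof.
have g_ge0 := ltW gamma_gt0.
apply/eqP; rewrite eq_le; apply/andP; split.
  apply: blk_norm_le => [|j z]; first by rewrite mulr_ge0 ?blk_norm_ge0.
  have /= [-> <-] := sqn_standard a z.
  by rewrite exprMn -[leRHS]mulrA ler_pM2l ?exprn_gt0 // blk_norm_bound.
rewrite mulrC -ler_pdivlMr //.
apply: blk_norm_le => [|i]; first by rewrite divr_ge0 ?blk_norm_ge0.
have [j <-] : exists j, pi j = i by exists (pi^-1%g i); rewrite permKV.
move=> z.
pose z1 := (v j)^t* *m cjif (j \in S) (castmx (pi_dim j, erefl) z).
have vz1 : v j *m z1 = cjif (j \in S) (castmx (pi_dim j, erefl) z).
  by rewrite mulmxA vvj' mul1mx.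
have /= := sqn_standard a z1.
rewrite vz1 cjifK castmx_comp castmx_id => -[h nz].
rewrite expr_div_n mulrAC ler_pdivlMr ?exprn_gt0 // mulrC -h nz.
exact: blk_norm_bound.
Qed.

Lemma blk_standardD : {morph blk_standard : a b / a + b}.
Proof. by move=> a b; rewrite /blk_standard blk_twistD mulrDr mulrDl scalerDr. Qed.

(** The twist is multiplicative and onto, so that every right multiple of the image
    of [b] is the image of a right multiple of [b]; and norms are scaled. *)
Lemma standard_preserves a b : strong_BJ_orthogonal a b ->
  strong_BJ_orthogonal (blk_standard a) (blk_standard b).
Proof.
move=> ab c; have [d dE] := blk_twist_surj (v * c * blk_star v).
suff -> : blk_standard a + blk_standard b * c = blk_standard (a + b * d).
  by rewrite !blk_norm_standard ler_pM2l //; exact: ab.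
rewrite blk_standardD; congr (_ + _); rewrite /blk_standard blk_twistM dE.
have vv : blk_star v * v = 1 := vu.1.
rewrite !mulrA -(mulrA _ (blk_star v)) vv mulr1.
apply: blkP => j; rewrite -[LHS]/((_ *: _) *m _) -[RHS]/(_ *: _).
by rewrite -scalemxAl.
Qed.

End Standard.


(** * Additive maps controlled by norms *)

Lemma nat_between (R : realType) (x y : R) : 0 <= x -> x < y ->
  exists p q : nat, [/\ (0 < p)%N, x * p%:R < q%:R & q%:R < y * p%:R].
Proof.
move=> x_ge0 xy; have d_gt0 : 0 < y - x by rewrite subr_gt0.
pose p := (Num.truncn (y - x)^-1).+1; pose q := (Num.truncn (x * p%:R)).+1.
have p_gt : (y - x)^-1 < p%:R by rewrite truncnS_gt.
have q_gt : x * p%:R < q%:R by rewrite truncnS_gt.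
exists p, q; split=> //.
have q_le : q%:R <= x * p%:R + 1.
  rewrite /q -natr1 lerD2r.
  have /truncn_itv/andP[//] : 0 <= x * p%:R by rewrite mulr_ge0.
apply: (le_lt_trans q_le).
have : 1 < (y - x) * p%:R by rewrite -ltr_pdivrMl // mulr1.
by rewrite mulrBl; move: (x * _) (y * _) => X Y; lra.
Qed.

(** [be] and [s] are the values at [al] and at [1] of a monotone function that
    is homogeneous over the naturals: the hypotheses compare multiples. Such a
    function is linear; the squares come from its being applied to squared
    norms. *)
Lemma nat_monotone_linear (R : realType) (al be s : R) :
  0 <= al -> 0 <= be -> 0 < s ->
  (forall p q : nat, p%:R ^+ 2 * al <= q%:R ^+ 2 -> p%:R ^+ 2 * be <= q%:R ^+ 2 * s) ->
  (forall p q : nat, q%:R ^+ 2 <= p%:R ^+ 2 * al -> q%:R ^+ 2 * s <= p%:R ^+ 2 * be) ->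
  be = s * al.
Proof.
move=> al_ge0 be_ge0 s_gt0 h1 h2.
have [a [a_ge0 aE]] : exists a, 0 <= a /\ al = a ^+ 2.
  by exists (Num.sqrt al); rewrite sqrtr_ge0 sqr_sqrtr.
have [b [b_ge0 bE]] : exists b, 0 <= b /\ be = s * b ^+ 2.
  exists (Num.sqrt (be / s)); split; first exact: sqrtr_ge0.
  by rewrite sqr_sqrtr ?divr_ge0 ?(ltW s_gt0) // mulrC divfK // gt_eqF.
suff ab : a = b by rewrite aE bE ab.
have sq_lt (x : R) (p q : nat) : 0 <= x -> x * p%:R < q%:R -> p%:R ^+ 2 * x ^+ 2 < q%:R ^+ 2.
  move=> x0 h; rewrite -exprMn mulrC ltr_sqr ?nnegrE ?mulr_ge0 //.
have lt_sq (x : R) (p q : nat) : 0 <= x -> q%:R < x * p%:R -> q%:R ^+ 2 < p%:R ^+ 2 * x ^+ 2.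
  move=> x0 h; rewrite -exprMn [_ * x]mulrC ltr_sqr ?nnegrE ?mulr_ge0 //.
have [ab|ba|//] := ltgtP a b.
  have [p [q [_ l1 l2]]] := nat_between a_ge0 ab.
  have l4 := sq_lt _ _ _ a_ge0 l1.
  have l3 := lt_sq _ _ _ b_ge0 l2.
  have := h1 p q; rewrite aE ltW // => /(_ isT).
  rewrite bE mulrCA mulrC ler_pM2r //; lra.
have [p [q [_ l2 l1]]] := nat_between b_ge0 ba.
have l3 := sq_lt _ _ _ b_ge0 l2.
have l4 := lt_sq _ _ _ a_ge0 l1.
have := h2 p q; rewrite aE ltW // => /(_ isT).
rewrite bE mulrCA mulrC ler_pM2l //; lra.
Qed.

Lemma nat_limit_le (R : realType) (x y : R) : 0 <= y ->
  (forall q : nat, q%:R ^+ 2 * x <= q.+1%:R ^+ 2 * y) -> x <= y.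
Proof.
move=> y_ge0 h; rewrite leNgt; apply/negP => yx.
have d_gt0 : 0 < x - y by rewrite subr_gt0.
pose q := (Num.truncn (3 * y / (x - y))).+1.
have q_gt : 3 * y / (x - y) < q%:R by rewrite truncnS_gt.
have q_ge1 : (1 : R) <= q%:R by rewrite ler1n.
have := h q; rewrite -natr1; move: q_gt q_ge1; rewrite ltr_pdivrMr //.
move: (q%:R : R) => z zd z1 hz.
have h1 : z * (3 * y) < z * (z * (x - y)) by rewrite ltr_pM2l //; lra.
have h2 : (2 * z + 1) * y <= 3 * z * y by rewrite ler_wpM2r //; lra.
have h3 : z ^+ 2 * x - (z + 1) ^+ 2 * y = z * (z * (x - y)) - (2 * z + 1) * y by ring.
have h4 : z * (3 * y) = 3 * z * y by ring.
lra.
Qed.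

Section AdditiveIsometry.
Variable (R : realType).
Local Notation C := R[i].

Definition cj (s : bool) (z : C) : C := if s then Num.conj z else z.

Lemma sqcRI (z : C) : sqc z = complex.Re z ^+ 2 + complex.Im z ^+ 2.
Proof.
case: z => a b; rewrite /sqc /= sqr_sqrtr //.
by rewrite addr_ge0 ?sqr_ge0.
Qed.

(** Polarization makes [f] preserve the real inner product of the plane, so that it
    is a real isometry fixing [1], hence the identity or the conjugation. *)
Lemma additive_isometry (f : C -> C) : {morph f : z w / z + w} ->
  (forall z, sqc (f z) = sqc z) -> f 1 = 1 ->
  exists s, forall z, f z = cj s z.
Proof.
move=> fD fN f1.
have dot z w : complex.Re (f z) * complex.Re (f w) + complex.Im (f z) * complex.Im (f w) =
    complex.Re z * complex.Re w + complex.Im z * complex.Im w.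
  have := fN (z + w); rewrite fD !sqcRI !raddfD /=.
  have := fN z; have := fN w; rewrite !sqcRI.
  case: (f z) => a b; case: (f w) => c d; case: z => a' b'; case: w => c' d' /=.
  move=> h1 h2 h3; nra.
have ReE z : complex.Re (f z) = complex.Re z.
  by have := dot z 1; rewrite f1 /= !mulr1 !mulr0 !addr0.
pose e := complex.Im (f 'i%C).
have e2 : e ^+ 2 = 1.
  by have := fN 'i%C; rewrite !sqcRI ReE /= expr0n expr1n !add0r.
have ImE z : complex.Im (f z) = e * complex.Im z.
  have := dot z 'i%C; rewrite !ReE /= mulr0 !add0r mulr1 => <-.
  by rewrite mulrCA -expr2 e2 mulr1.
move/eqP: e2; rewrite sqrf_eq1 => /orP[]/eqP eE; [exists false|exists true] => z;
  apply/eqP; rewrite eq_complex ReE ImE eE.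
- by rewrite /= mul1r !eqxx.
- by rewrite /= conjE mulN1r; case: z => a b /=; rewrite !eqxx.
Qed.
End AdditiveIsometry.


(** * Maps acting on each block through its rows *)

Section BlockDiagonal.
Variables (R : realType) (k : nat) (n : 'I_k -> nat).
Hypothesis n_gt0 : forall j, (0 < n j)%N.
Local Notation C := R[i].
Local Notation A := (blockalg R n).
Implicit Types (a b c : A).

Variables (Phi : A -> A) (Y : forall j, 'M[C]_(n j))
  (T : forall j, 'rV[C]_(n j) -> 'rV[C]_(n j)).
Hypothesis Phi_additive : {morph Phi : a b / a + b}.
Hypothesis Phi_orth :
  forall a b, strong_BJ_orthogonal a b -> strong_BJ_orthogonal (Phi a) (Phi b).
Hypothesis Y_unit : forall j, Y j \in unitmx.
Hypothesis T_additive : forall j, {morph @T j : u v / u + v}.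
Hypothesis T_surj : forall j (v : 'rV[C]_(n j)), exists u : 'rV[C]_(n j), T u = v.
Hypothesis PhiE : forall a j s, row s (Phi a j) = T (row s (Y j *m a j)).

(** Phrased with values of ordinals because the types of [s] and [m] depend on
    the blocks. *)
Definition distinct_rows j (s : 'I_(n j)) l (m : 'I_(n l)) :=
  (j != l) || (s != m :> nat).

Hypothesis two_rows : forall j (s : 'I_(n j)), exists l (m : 'I_(n l)),
  distinct_rows s m.

Let k_gt0 (j : 'I_k) : (0 < k)%N := leq_ltn_trans (leq0n j) (ltn_ord j).

Lemma distinct_rows_sym j (s : 'I_(n j)) l (m : 'I_(n l)) :
  distinct_rows s m -> distinct_rows m s.
Proof. by rewrite /distinct_rows [l == j]eq_sym [val m == _]eq_sym. Qed.

Lemma T0 j : T (0 : 'rV[C]_(n j)) = 0.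
Proof. by apply: (addrI (T 0)); rewrite -T_additive !addr0. Qed.

Lemma TMn j (u : 'rV[C]_(n j)) q : T (u *+ q) = T u *+ q.
Proof. by elim: q => [|q IH]; rewrite ?T0 // !mulrS T_additive IH. Qed.

Lemma rY_neq0 j (s : 'I_(n j)) : 0 < sqn (row s (Y j)).
Proof.
rewrite sqn_gt0; apply/eqP => h.
have := congr1 (fun r => r *m invmx (Y j)) h.
rewrite rowE -mulmxA mulmxV // mulmx1 mul0mx => /eqP.
by rewrite -sqn_eq0 sqn_delta oner_eq0.
Qed.

Lemma T_nontrivial j : exists u : 'rV[C]_(n j), T u != 0.
Proof.
have [u uE] := T_surj (delta_mx 0 (Ordinal (n_gt0 j)) : 'rV[C]_(n j)).
by exists u; rewrite uE -sqn_eq0 sqn_delta oner_eq0.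
Qed.

(** The element whose image under [Phi] has the single nonzero row [T u], in
    position [s] of the block [j]. *)
Definition preset j (s : 'I_(n j)) (u : 'rV[C]_(n j)) : A :=
  blk_in (invmx (Y j) *m (delta_mx s 0 *m u)).

Lemma Phi_preset j (s : 'I_(n j)) u :
  Phi (preset s u) = blk_in (delta_mx s 0 *m T u).
Proof.
apply: blkP => i; apply/row_matrixP => l; rewrite PhiE /preset.
have [ij|ij] := eqVneq i j; last by rewrite !blk_in_other // mulmx0 !row0 T0.
move: l; rewrite ij => l; rewrite !blk_in_same mulKVmx //.
rewrite !row_mul row_delta_col.
by case: (l == s); rewrite ?mul1mx // raddf0 !mul0mx T0.
Qed.

(** Let [r] be a top row of [a]. Every [b] with [r b = 0] has an image whose row
    [s] vanishes, that is, [T] kills [row s (Y j) *m b j]. As [T] is not zero, this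
    forces [row s (Y j)] to be a multiple of [r]. *)
Lemma top_row_pullback a j (s : 'I_(n j)) :
  (forall b, strong_BJ_orthogonal (Phi a) b -> row s (b j) = 0) ->
  top_row a (row s (Y j)).
Proof.
move=> h; have [i [r [r0 ra]]] := exists_top_row a (k_gt0 j) n_gt0.
have Tr b : r *m b i = 0 -> T (row s (Y j) *m b j) = 0.
  by move=> /(top_row_orthogonal r0 ra)/Phi_orth/h; rewrite PhiE row_mul.
have [u Tu] := T_nontrivial j.
have [ij|ij] := eqVneq i j; last first.
  have := Tr (preset s u); rewrite /preset blk_in_other // mulmx0 => /(_ erefl).
  rewrite blk_in_same -row_mul mulKVmx // row_mul row_delta_col eqxx mul1mx.
  by move/eqP; rewrite (negbTE Tu).
move: r r0 ra Tr; rewrite {}ij => r r0 ra Tr.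
(* the component of the row of Y orthogonal to r *)
pose q := row s (Y j) - ((row s (Y j) *m r^t*) 0 0 / (sqn r)%:C) *: r.
have qr : q *m r^t* = 0.
  rewrite mulmxBl -scalemxAl row_sqn; apply/matrixP => x y.
  rewrite !ord1 !mxE eqxx mulr1n divfK ?fmorph_eq0 ?gt_eqF ?sqn_gt0 //.
  by rewrite subrr.
have q0 : q = 0.
  apply/eqP/negP => /negP q0; move/negP: Tu; apply.
  have := Tr (blk_in (q^t* *m ((sqn q)%:C^-1 *: u))).
  rewrite blk_in_same !mulmxA.
  have -> : r *m q^t* = 0 by rewrite -[LHS]trmxCK ctmxM trmxCK qr ctmx0.
  rewrite mul0mx => /(_ erefl).
  have -> : row s (Y j) *m q^t* = (sqn q)%:C%:M.
    rewrite -row_sqn {2}/q mulmxBl -scalemxAl.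
    have -> : r *m q^t* = 0 by rewrite -[LHS]trmxCK ctmxM trmxCK qr ctmx0.
    by rewrite scaler0 subr0.
  rewrite mul_scalar_mx scalerA mulfV ?scale1r ?fmorph_eq0 ?gt_eqF ?sqn_gt0 //.
  by move=> ->.
have -> : row s (Y j) = ((row s (Y j) *m r^t*) 0 0 / (sqn r)%:C) *: r.
  by apply/eqP; rewrite -subr_eq0 -/q q0.
by rewrite /top_row -!scalemxAl ra !scalerA mulrC.
Qed.


(** The basic experiment: an element whose image has the two rows [T u] and [T v],
    the first of which dominates the other and is orthogonal to it. *)
Section TwoRows.
Variables (j : 'I_k) (s : 'I_(n j)) (u : 'rV[C]_(n j)).
Variables (l : 'I_k) (m : 'I_(n l)) (v : 'rV[C]_(n l)).
Hypothesis sm : distinct_rows s m.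
Hypothesis Tvu : sqn (T v) < sqn (T u).
Hypothesis Tvu_orth : blk_in (delta_mx m 0 *m T v) j *m (T u)^t* = 0.

Local Notation a := (preset s u + preset m v).

Lemma distinct_preset (w : 'rV[C]_(n l)) : row s (Y j *m preset m w j) = 0.
Proof.
rewrite /preset; move: sm; rewrite /distinct_rows.
have [jl /= sm'|jl _] := eqVneq j l; last by rewrite blk_in_other // mulmx0 row0.
move: m s sm' w; rewrite -jl => m' s' sm' w; rewrite blk_in_same mulKVmx // row_mul.
by rewrite row_delta_col -val_eqE (negbTE sm') raddf0 mul0mx.
Qed.

Lemma preset_same : row s (Y j *m preset s u j) = u.
Proof.
by rewrite /preset blk_in_same mulKVmx // row_mul row_delta_col eqxx mul1mx.
Qed.

Lemma two_rows_top : top_row a (row s (Y j)).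
Proof.
apply: top_row_pullback => b; rewrite Phi_additive !Phi_preset => ab.
have Tu0 : T u != 0 by rewrite -sqn_gt0 (le_lt_trans (sqn_ge0 _) Tvu).
have wt : (delta_mx s 0 : 'cV[C]_(n j))^t* *m blk_in (delta_mx m 0 *m T v) j = 0.
  rewrite ctmx_delta -rowE; move: sm; rewrite /distinct_rows.
  have [jl /= sm'|jl _] := eqVneq j l; last by rewrite blk_in_other // row0.
  move: m s sm' (T v); rewrite -jl => m' s' sm' w; rewrite blk_in_same row_mul.
  by rewrite row_delta_col -val_eqE (negbTE sm') raddf0 mul0mx.
have tb i (z : 'cV[C]_(n i)) :
    sqn (blk_in (delta_mx m 0 *m T v) i *m z) <= sqn (T v) * sqn z.
  have [il|il] := eqVneq i l; last first.
    by rewrite blk_in_other // mul0mx sqn0 mulr_ge0 ?sqn_ge0.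
  move: z; rewrite il => z; rewrite blk_in_same -mulmxA.
  by rewrite sqn_mul_scalar sqn_delta mul1r cauchy_schwarz.
have lt1 : sqn (T v) < sqn (delta_mx s 0 : 'cV[C]_(n j)) * sqn (T u).
  by rewrite sqn_delta mul1r.
have := peak_orthogonal Tu0 wt Tvu_orth tb n_gt0 lt1 ab.
by rewrite ctmx_delta -rowE.
Qed.

Lemma two_rows_value : row s (Y j) *m a j = u.
Proof.
rewrite mulmxDr -!row_mul -[RHS]addr0 -[in RHS](distinct_preset v).
by congr (_ + _); exact: preset_same.
Qed.

End TwoRows.

(** The row of [Y] of index [s] is a top row, so that it attains the norm of the
    element, while the row of index [m] need not. *)
Lemma two_rows_bound j (s : 'I_(n j)) (u : 'rV[C]_(n j)) l (m : 'I_(n l))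
    (v : 'rV[C]_(n l)) :
  distinct_rows s m -> sqn (T v) < sqn (T u) ->
  blk_in (delta_mx m 0 *m T v) j *m (T u)^t* = 0 ->
  sqn v * sqn (row s (Y j)) <= sqn u * sqn (row m (Y l)).
Proof.
move=> sm Tvu o; set a := preset s u + preset m v.
have top : top_row a (row s (Y j)) by exact: two_rows_top.
have vE : row m (Y l) *m a l = v.
  by rewrite /a addrC; apply: two_rows_value; exact: distinct_rows_sym.
have := blk_norm_row_bound a (row m (Y l)); rewrite vE => le1.
have := top_row_sqn top; rewrite two_rows_value // => ->.
rewrite mulrAC ler_wpM2r ?sqn_ge0 //.
Qed.

Lemma two_rows_inner j (s m : 'I_(n j)) (u v : 'rV[C]_(n j)) :
  s != m -> sqn (T v) < sqn (T u) -> T v *m (T u)^t* = 0 ->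
  (sqn (row s (Y j)))%:C *: (u *m v^t*) =
  (sqn u)%:C *: (row s (Y j) *m (row m (Y j))^t*).
Proof.
move=> sm Tvu o; set a := preset s u + preset m v.
have dsm : distinct_rows s m by rewrite /distinct_rows sm orbT.
have o' : blk_in (delta_mx m 0 *m T v) j *m (T u)^t* = 0.
  by rewrite blk_in_same -mulmxA o mulmx0.
have top : top_row a (row s (Y j)) by exact: two_rows_top.
have uE : row s (Y j) *m a j = u by exact: two_rows_value.
have vE : row m (Y j) *m a j = v.
  by rewrite /a addrC; apply: two_rows_value; exact: distinct_rows_sym.
have uN := top_row_sqn top; rewrite uE in uN.
move: top; rewrite /top_row uE => top.
rewrite -[in v^t*]vE ctmxM mulmxA top uN -scalemxAl scalerA.
by rewrite -rmorphM mulrC.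
Qed.

(** A vector killed by [T] has all its multiples dominated by a fixed vector. *)
Lemma T_inj0 l (v : 'rV[C]_(n l)) : T v = 0 -> v = 0.
Proof.
move=> Tv0; pose m := Ordinal (n_gt0 l).
have [j [s /distinct_rows_sym sm]] := two_rows m.
have [u Tu0] := T_nontrivial j.
have le q : (sqn v * sqn (row s (Y j))) * q%:R <= sqn u * sqn (row m (Y l)).
  have Tq : T (v *+ q) = 0 by rewrite TMn Tv0 mul0rn.
  have := @two_rows_bound j s u l m (v *+ q) sm.
  rewrite Tq sqn0 mulmx0 blk_in0 mul0mx.
  rewrite sqn_gt0 Tu0 => /(_ isT erefl); apply: le_trans.
  rewrite sqnMn -(mulrA (_ ^+ 2)) [leLHS]mulrC ler_wpM2r ?mulr_ge0 ?sqn_ge0 //.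
  by rewrite expr2 -natrM ler_nat; case: (q) => // q'; exact: leq_pmulr.
apply/eqP; rewrite -sqn_eq0; apply/negPn/negP => v0.
have K_gt0 : 0 < sqn v * sqn (row s (Y j)).
  by rewrite mulr_gt0 ?rY_neq0 // lt_def v0 sqn_ge0.
set B := sqn u * _ in le.
have B_ge0 : 0 <= B by rewrite mulr_ge0 ?sqn_ge0.
have := le (Num.truncn (B / (sqn v * sqn (row s (Y j))))).+1.
by rewrite -ler_pdivlMl // leNgt mulrC truncnS_gt.
Qed.

Lemma TB j (u v : 'rV[C]_(n j)) : T (u - v) = T u - T v.
Proof. by apply/eqP; rewrite eq_sym subr_eq -T_additive subrK. Qed.

Lemma T_inj j : injective (@T j).
Proof.
by move=> u v /eqP; rewrite -subr_eq0 -TB => /eqP/T_inj0/eqP; rewrite subr_eq0 => /eqP.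
Qed.

Definition Tinv j (x : 'rV[C]_(n j)) := sval (cid (T_surj x)).

Lemma TinvK j (x : 'rV[C]_(n j)) : T (Tinv x) = x.
Proof. exact: (svalP (cid (T_surj x))). Qed.

Lemma TK j (u : 'rV[C]_(n j)) : Tinv (T u) = u.
Proof. by apply: T_inj; rewrite TinvK. Qed.

Lemma TinvD j : {morph @Tinv j : x y / x + y}.
Proof. by move=> x y; apply: T_inj; rewrite T_additive !TinvK. Qed.

Lemma TinvB j (x y : 'rV[C]_(n j)) : Tinv (x - y) = Tinv x - Tinv y.
Proof. by apply: T_inj; rewrite TB !TinvK. Qed.

Lemma Tinv0 j : Tinv (0 : 'rV[C]_(n j)) = 0.
Proof. by apply: T_inj; rewrite TinvK T0. Qed.

Lemma TinvMn j (x : 'rV[C]_(n j)) q : Tinv (x *+ q) = Tinv x *+ q.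
Proof. by apply: T_inj; rewrite TMn !TinvK. Qed.

Lemma blk_orthMn j (x : 'rV[C]_(n j)) l (m : 'I_(n l)) (x' : 'rV[C]_(n l)) p q :
  blk_in (delta_mx m 0 *m x') j *m x^t* = 0 ->
  blk_in (delta_mx m 0 *m (x' *+ q)) j *m (x *+ p)^t* = 0.
Proof.
have [jl|jl] := eqVneq j l; last by rewrite !(blk_in_other _ jl) !mul0mx.
subst l; rewrite !blk_in_same -(scaler_nat q x') -(scaler_nat p x) -scalemxAr ctmxZ => h.
by rewrite -scalemxAl -scalemxAr h !scaler0.
Qed.

(** The bound of [two_rows_bound] survives in the non-strict case, by comparing
    the multiples by [q] and [q + 1]. *)
Lemma Tinv_compare j (s : 'I_(n j)) (x : 'rV[C]_(n j)) l (m : 'I_(n l))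
    (x' : 'rV[C]_(n l)) :
  distinct_rows s m -> sqn x' <= sqn x ->
  blk_in (delta_mx m 0 *m x') j *m x^t* = 0 ->
  sqn (Tinv x') * sqn (row s (Y j)) <= sqn (Tinv x) * sqn (row m (Y l)).
Proof.
move=> sm xx o.
have [x0|x_neq0] := eqVneq x 0.
  have -> : x' = 0.
    by apply/eqP; rewrite -sqn_eq0 eq_le sqn_ge0 (le_trans xx) // x0 sqn0.
  by rewrite Tinv0 sqn0 mul0r mulr_ge0 ?sqn_ge0.
apply: nat_limit_le => [|q]; first by rewrite mulr_ge0 ?sqn_ge0.
rewrite [leLHS]mulrA [leRHS]mulrA -(sqnMn (Tinv x')) -(sqnMn (Tinv x)).
apply: two_rows_bound => //.
  rewrite !TMn !TinvK !sqnMn.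
  rewrite (@le_lt_trans _ _ (q%:R ^+ 2 * sqn x)) // ?ler_wpM2l ?sqr_ge0 //.
  by rewrite ltr_pM2r ?sqn_gt0 // ltr_sqr ?nnegrE ?ler0n // ltr_nat.
by rewrite !TMn !TinvK; exact: blk_orthMn.
Qed.

Lemma rows_orthogonal j (s m : 'I_(n j)) : s != m ->
  row s (Y j) *m (row m (Y j))^t* = 0.
Proof.
move=> sm; have [u Tu0] := T_nontrivial j.
have := two_rows_inner sm (u := u) (v := 0).
rewrite T0 sqn0 sqn_gt0 Tu0 mul0mx ctmx0 mulmx0 scaler0 => /(_ isT erefl)/esym/eqP.
rewrite scaler_eq0 fmorph_eq0 sqn_eq0 => /orP[/eqP u0|/eqP//].
by move: Tu0; rewrite u0 T0 eqxx.
Qed.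

(** A multiple of [x] dominates [x'], and the rows of [Y] are orthogonal. *)
Lemma Tinv_orthogonal j (s m : 'I_(n j)) (x x' : 'rV[C]_(n j)) : s != m ->
  x' *m x^t* = 0 -> Tinv x *m (Tinv x')^t* = 0.
Proof.
move=> sm o; have [->|x0] := eqVneq x 0; first by rewrite Tinv0 mul0mx.
pose q := (Num.truncn (sqn x' / sqn x)).+1.
have x_gt0 : 0 < sqn x by rewrite sqn_gt0.
have q_gt : sqn x' < q%:R ^+ 2 * sqn x.
  rewrite -ltr_pdivrMr //; apply: (@lt_le_trans _ _ q%:R).
    by rewrite truncnS_gt.
  by rewrite expr2 -natrM ler_nat leq_pmulr.
have := two_rows_inner sm (u := Tinv x *+ q) (v := Tinv x').
rewrite TMn !TinvK !sqnMn q_gt rows_orthogonal // scaler0.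
rewrite -(scaler_nat q x) ctmxZ -scalemxAr o scaler0 => /(_ isT erefl)/eqP.
rewrite -(scaler_nat q (Tinv x)) -scalemxAl !scaler_eq0 fmorph_eq0 gt_eqF ?rY_neq0 //= pnatr_eq0 /=.
by move/eqP.
Qed.

Local Notation e s := (delta_mx 0 s : 'rV[C]_(n _)).

Lemma sqnZ_delta j (s : 'I_(n j)) (la : C) : sqn (la *: e s) = sqc la.
Proof. by rewrite sqnZ sqn_delta mulr1. Qed.

Lemma delta_orthogonal j (s : 'I_(n j)) l (m : 'I_(n l)) (la mu : C) :
  distinct_rows s m ->
  blk_in (delta_mx m 0 *m (la *: e m)) j *m (mu *: e s)^t* = 0.
Proof.
rewrite /distinct_rows; have [jl /= sm|jl _] := eqVneq j l; last first.
  by rewrite blk_in_other // mul0mx.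
subst l; rewrite blk_in_same -scalemxAr -scalemxAl ctmxZ -scalemxAr ctmx_delta.
by rewrite -mulmxA mul_delta_mx_0 1?eq_sym ?val_eqE // mulmx0 !scaler0.
Qed.

(** The squared norm of the inverse of [T] on a coordinate axis, in the unit given
    by the corresponding row of [Y]: in this unit the comparison of two rows is
    symmetric. *)
Definition gauge j (s : 'I_(n j)) (la : C) :=
  sqn (Tinv (la *: e s)) / sqn (row s (Y j)).

Lemma gauge_mono_distinct j (s : 'I_(n j)) l (m : 'I_(n l)) (la mu : C) :
  distinct_rows s m -> sqc la <= sqc mu -> gauge m la <= gauge s mu.
Proof.
move=> sm lamu; rewrite /gauge ler_pdivrMr ?rY_neq0 // mulrAC.
rewrite ler_pdivlMr ?rY_neq0 //; apply: Tinv_compare => //.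
  by rewrite !sqnZ_delta.
exact: delta_orthogonal.
Qed.

(** A row is compared with itself through a second row. *)
Lemma gauge_mono j (s : 'I_(n j)) l (m : 'I_(n l)) (la mu : C) :
  sqc la <= sqc mu -> gauge m la <= gauge s mu.
Proof.
move=> lamu; have [sm|] := boolP (distinct_rows s m).
  exact: gauge_mono_distinct.
rewrite /distinct_rows negb_or !negbK => /andP[/eqP jl].
subst l; rewrite val_eqE => /eqP sm; subst m.
have [l [m sm]] := two_rows s.
apply: (@le_trans _ _ (gauge m mu)).
  by apply: gauge_mono_distinct => //; exact: distinct_rows_sym.
exact: gauge_mono_distinct.
Qed.

Lemma gaugeMn j (s : 'I_(n j)) (la : C) q :
  gauge s (la *+ q) = q%:R ^+ 2 * gauge s la.
Proof. by rewrite /gauge -scalerMnl TinvMn sqnMn mulrA. Qed.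

Lemma gauge_gt0 j (s : 'I_(n j)) : 0 < gauge s 1.
Proof.
rewrite divr_gt0 ?rY_neq0 // sqn_gt0; apply/eqP => h.
have := TinvK (1 *: e s); rewrite h T0 scale1r => /esym/eqP.
by rewrite -sqn_eq0 sqn_delta oner_eq0.
Qed.

(** All the gauges are the same function, which is monotone in the modulus. As
    the function does not depend on the block, neither does the final scalar. *)
Lemma gauge_linear j0 (s0 : 'I_(n j0)) j (s : 'I_(n j)) (la : C) :
  gauge s la = gauge s0 1 * sqc la.
Proof.
have sqcMn (z : C) q : sqc (z *+ q) = q%:R ^+ 2 * sqc z.
  by rewrite -(mulr_natl z q) sqcM -(rmorph_nat (real_complex R)) sqcR.
apply: nat_monotone_linear => [|||p q h|p q h].
- exact: sqc_ge0.
- by rewrite divr_ge0 ?sqn_ge0.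
- exact: gauge_gt0.
- by rewrite -(gaugeMn s) -(gaugeMn s0) gauge_mono // !sqcMn sqc1 mulr1.
- by rewrite -(gaugeMn s) -(gaugeMn s0) gauge_mono // !sqcMn sqc1 mulr1.
Qed.

Lemma sqn_Tinv_delta j0 (s0 : 'I_(n j0)) j (s : 'I_(n j)) (la : C) :
  sqn (Tinv (la *: e s)) = gauge s0 1 * sqc la * sqn (row s (Y j)).
Proof. by rewrite -(gauge_linear s0 s) divfK // gt_eqF ?rY_neq0. Qed.

(** Two rows of [Y] are compared with the coordinate axes exchanged, so that each
    side of the inequality carries the fourth power of the length of one row. *)
Lemma sqn_rY j (s m : 'I_(n j)) : sqn (row s (Y j)) = sqn (row m (Y j)).
Proof.
suff le (s' m' : 'I_(n j)) : s' != m' ->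
    sqn (row s' (Y j)) <= sqn (row m' (Y j)).
  have [->//|sm] := eqVneq s m.
  by apply/eqP; rewrite eq_le !le // eq_sym.
move=> sm.
have d : distinct_rows s' m' by rewrite /distinct_rows sm orbT.
have := @Tinv_compare j s' (1 *: e m') j m' (1 *: e s') d.
rewrite !sqnZ_delta lexx !(sqn_Tinv_delta s') => /(_ isT).
rewrite blk_in_same !scale1r ctmx_delta -mulmxA mul_delta_mx_0 // mulmx0.
move=> /(_ erefl); rewrite sqc1 mulr1 -!(mulrA (gauge s' 1)).
by rewrite ler_pM2l ?gauge_gt0 // -!expr2 ler_sqr ?nnegrE ?sqn_ge0.
Qed.

Lemma gram_scalar p (M : 'M[C]_p) (c : R) :
  (forall s, sqn (row s M) = c) ->
  (forall s m, s != m -> row s M *m (row m M)^t* = 0) ->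
  M *m M^t* = c%:C%:M.
Proof.
move=> hc ho; apply/matrixP => s m.
have -> : (M *m M^t*) s m = (row s M *m (row m M)^t*) 0 0.
  by rewrite !mxE; apply: eq_bigr => l _; rewrite !mxE.
have [<-|sm] := eqVneq s m; first by rewrite row_sqn hc !mxE !eqxx.
by rewrite ho // !mxE (negbTE sm).
Qed.

Lemma scaled_unitary p (M : 'M[C]_p) (c : R) : 0 < c -> M *m M^t* = c%:C%:M ->
  let U := (Num.sqrt c)^-1%:C *: M in U^t* *m U = 1%:M /\ U *m U^t* = 1%:M.
Proof.
move=> c_gt0 MM U.
have UU : U *m U^t* = 1%:M.
    rewrite /U ctmxZ conjE conjc_real -scalemxAl -scalemxAr MM scalerA.
  have real1 : (Num.sqrt c)^-1 * (Num.sqrt c)^-1 * c = 1.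
    by rewrite -invfM -expr2 sqr_sqrtr ?(ltW c_gt0) // mulVf // gt_eqF.
  rewrite scale_scalar_mx; congr (_%:M).
  have := congr1 (fun x : R => x%:C) real1.
  by move: (_^-1) => x; rewrite rmorphM [X in X * _]rmorphM.
exact: (conj (mulmx1C UU) UU).
Qed.

Section Block.
Variable j : 'I_k.
Variable j0 : 'I_k.
Variable s0 : 'I_(n j0).
Local Notation sigma := (gauge s0 1).
Let s1 : 'I_(n j) := Ordinal (n_gt0 j).
Local Notation rho := (sqn (row s1 (Y j))).

Definition frame : 'M[C]_(n j) := \matrix_(s < n j) Tinv (e s).

Lemma row_frame (s : 'I_(n j)) : row s frame = Tinv (e s).
Proof. exact: rowK. Qed.

Lemma sqn_frame (s : 'I_(n j)) : sqn (Tinv (e s)) = sigma * rho.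
Proof.
rewrite -[e s]scale1r (sqn_Tinv_delta s0) (sqn_rY _ s1).
by rewrite sqc1 mulr1.
Qed.

Lemma sigma_rho_gt0 : 0 < sigma * rho.
Proof. by rewrite mulr_gt0 ?gauge_gt0 ?rY_neq0. Qed.

Lemma Tinv_delta_orthogonal (s m : 'I_(n j)) (la mu : C) : s != m ->
  Tinv (la *: e s) *m (Tinv (mu *: e m))^t* = 0.
Proof.
move=> sm; apply: (Tinv_orthogonal sm).
rewrite -scalemxAl ctmxZ -scalemxAr ctmx_delta mul_delta_mx_0 1?eq_sym //.
by rewrite !scaler0.
Qed.

Lemma frame_gram : frame *m frame^t* = (sigma * rho)%:C%:M.
Proof.
apply: gram_scalar => [s|s m sm]; first by rewrite row_frame sqn_frame.
rewrite !row_frame -[e s]scale1r -[e m]scale1r.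
exact: Tinv_delta_orthogonal.
Qed.

Definition coef (s : 'I_(n j)) (la : C) : C :=
  (Tinv (la *: e s) *m (Tinv (e s))^t*) 0 0 / (sigma * rho)%:C.

Let sr0 : (sigma * rho)%:C != 0.
Proof. by rewrite fmorph_eq0 gt_eqF // sigma_rho_gt0. Qed.

(** The inverse of [T] respects the orthogonality of the coordinate axes, so that
    it sends each of them into a line. *)
Lemma coefE (s : 'I_(n j)) la : Tinv (la *: e s) = coef s la *: Tinv (e s).
Proof.
apply/eqP; rewrite -subr_eq0; apply/eqP.
set d := (_ - _); suff dW : d *m frame^t* = 0.
  have := congr1 (fun M => d *m M) (mulmx1C
    (_ : ((sigma * rho)%:C^-1 *: frame) *m frame^t* = 1%:M)).
  rewrite mulmxA dW mul0mx mulmx1 => -> //.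
  by rewrite -scalemxAl frame_gram scale_scalar_mx mulVf.
apply/matrixP => i m; rewrite ord1 [RHS]mxE.
have -> : (d *m frame^t*) 0 m = (d *m (row m frame)^t*) 0 0.
  by rewrite !mxE; apply: eq_bigr => l _; rewrite !mxE.
rewrite row_frame /d mulmxBl -scalemxAl.
have [->|ms] := eqVneq m s.
  rewrite row_sqn sqn_frame !mxE eqxx mulr1n /coef divfK //.
  by rewrite !mxE subrr.
rewrite eq_sym in ms; have := Tinv_delta_orthogonal la 1 ms.
have := Tinv_delta_orthogonal 1 1 ms; rewrite !scale1r => -> ->.
by rewrite scaler0 subr0 mxE.
Qed.

Lemma coefD s : {morph coef s : la mu / la + mu}.
Proof.
move=> la mu; rewrite /coef scalerDl TinvD mulmxDl -mulrDl; congr (_ / _).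
by rewrite !mxE.
Qed.

Lemma coef1 s : coef s 1 = 1.
Proof. by rewrite /coef scale1r row_sqn sqn_frame !mxE eqxx mulr1n divff. Qed.

Lemma sqc_coef s la : sqc (coef s la) = sqc la.
Proof.
apply: (mulIf (x := sigma * rho)); first by rewrite gt_eqF // sigma_rho_gt0.
rewrite -{1}(sqn_frame s) -sqnZ -coefE (sqn_Tinv_delta s0) (sqn_rY _ s1).
by rewrite -mulrA mulrCA.
Qed.

(** [la (e_s + e_m)] is orthogonal to [e_s - e_m], and so are their images. *)
Lemma coef_eq s m la : coef s la = coef m la.
Proof.
have [->//|sm] := eqVneq s m.
have o1 : (e s - e m) *m (la *: e s + la *: e m)^t* = 0.
  rewrite -scalerDr ctmxZ -scalemxAr ctmxD !ctmx_delta.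
  have ms : m != s by rewrite eq_sym.
  rewrite mulmxBl !mulmxDr !mul_delta_mx !mul_delta_mx_0 //.
  by rewrite addr0 add0r subrr scaler0.
have := Tinv_orthogonal sm o1; rewrite TinvB TinvD !coefE ctmxD ctmxN.
rewrite mulmxBr !mulmxDl -!scalemxAl !row_sqn !sqn_frame.
have := Tinv_delta_orthogonal 1 1 sm; rewrite !scale1r => ->.
have ms : m != s by rewrite eq_sym.
have := Tinv_delta_orthogonal 1 1 ms; rewrite !scale1r => ->.
rewrite !scaler0 addr0 add0r -scalerBl => /eqP.
rewrite scaler_eq0 => /orP[|/eqP/matrixP/(_ 0 0)].
  by rewrite subr_eq0 => /eqP.
by rewrite !mxE eqxx mulr1n => /eqP; rewrite (negbTE sr0).
Qed.

Lemma Tinv_form : exists b : bool, forall x : 'rV[C]_(n j), Tinv x = cjif b x *m frame.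
Proof.
have [b bE] := additive_isometry (@coefD s1) (sqc_coef s1) (coef1 s1).
exists b => x; rewrite {1}[x]row_sum_delta mulmx_sum_row.
rewrite (big_morph _ (@TinvD j) (@Tinv0 j)); apply: eq_bigr => s _.
rewrite coefE (coef_eq s s1) bE row_frame; congr (_ *: _).
by rewrite /cjif /cj; case: (b); rewrite ?mxE.
Qed.

Lemma T_form : exists b : bool, forall u : 'rV[C]_(n j),
  T u = cjif b (u *m ((sigma * rho)%:C^-1 *: frame^t*)).
Proof.
have [b bE] := Tinv_form; exists b => u.
have fK : frame *m ((sigma * rho)%:C^-1 *: frame^t*) = 1%:M.
  by rewrite -scalemxAr frame_gram scale_scalar_mx mulVf.
by rewrite -[u in RHS]TK bE -mulmxA fK mulmx1 cjifK.
Qed.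

Lemma rY_gram : Y j *m (Y j)^t* = rho%:C%:M.
Proof.
apply: gram_scalar => [s|s m sm]; first exact: sqn_rY.
exact: rows_orthogonal.
Qed.

Lemma block_form : exists (b : bool) (u v : 'M[C]_(n j)),
  [/\ u^t* *m u = 1%:M /\ u *m u^t* = 1%:M, v^t* *m v = 1%:M /\ v *m v^t* = 1%:M
    & forall a, Phi a j = (Num.sqrt sigma)^-1%:C *: (u *m cjif b (a j) *m v)].
Proof.
have [b bE] := T_form; exists b.
have rho_gt0 : 0 < rho by exact: rY_neq0.
have cj_unit (u : 'M[C]_(n j)) : u^t* *m u = 1%:M /\ u *m u^t* = 1%:M ->
    (cjif b u)^t* *m cjif b u = 1%:M /\ cjif b u *m (cjif b u)^t* = 1%:M.
  have cjt : (cjif b u)^t* = cjif b (u^t*) by case: (b) => //=; rewrite map_trmx.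
  have cj1 : cjif b 1%:M = 1%:M :> 'M[C]_(n j).
    by case: (b) => //=; rewrite map_mx1.
  by rewrite cjt -!cjifM => -[-> ->].
exists (cjif b ((Num.sqrt rho)^-1%:C *: Y j)),
  (cjif b ((Num.sqrt (sigma * rho))^-1%:C *: frame^t*)); split.
- by apply: cj_unit; exact: (scaled_unitary rho_gt0 rY_gram).
- have := scaled_unitary sigma_rho_gt0 frame_gram.
  set V := _ *: frame => -[h1 h2]; apply: cj_unit.
  have -> : (Num.sqrt (sigma * rho))^-1%:C *: frame^t* = V^t*.
    by rewrite ctmxZ conjE conjc_real.
  by rewrite trmxCK.
move=> a; rewrite -!cjifM.
have cjZ (x : R) (M : 'M[C]_(n j)) : x%:C *: cjif b M = cjif b (x%:C *: M).
  case: (b) => //=; apply/matrixP => p q; rewrite !mxE rmorphM.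
  by congr (_ * _); rewrite [RHS]conjE conjc_real.
rewrite cjZ; apply/row_matrixP => s; rewrite PhiE bE [RHS]cjif_row -row_mul.
congr (cjif b (row s _)).
rewrite -!scalemxAl -!scalemxAr !scalerA -fmorphV; congr (_ *: _).
have real1 : (sigma * rho)^-1 =
    (Num.sqrt sigma)^-1 * (Num.sqrt rho)^-1 * (Num.sqrt (sigma * rho))^-1.
  rewrite -!invfM -sqrtrM ?ltW ?gauge_gt0 // -expr2 sqr_sqrtr //.
  exact: (ltW sigma_rho_gt0).
have real3 (x y z : R) : (x * y * z)%:C = x%:C * y%:C * z%:C.
  by rewrite !rmorphM.
by rewrite real1; exact: real3.
Qed.
End Block.

Lemma block_diagonal_standard (k_gt0' : (0 < k)%N) :
  exists (gamma : R) (u v : A) (S : {set 'I_k}),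
    [/\ 0 < gamma, blk_unitary u, blk_unitary v
      & forall a, Phi a = gamma%:C *: (u * blk_dagger S a * v)].
Proof.
pose j0 := Ordinal k_gt0'; pose s0 := Ordinal (n_gt0 j0).
have form j := cid (block_form j s0).
pose b j := sval (form j); have form2 j := cid (svalP (form j)).
pose u j := sval (form2 j); have form3 j := cid (svalP (form2 j)).
pose v j := sval (form3 j).
exists (Num.sqrt (gauge s0 1))^-1, u, v, [set j | b j].
have bP j := svalP (form3 j).
split.
- by rewrite invr_gt0 sqrtr_gt0 gauge_gt0.
- by split; apply: blkP => j; have [[]] := bP j.
- by split; apply: blkP => j; have [_ []] := bP j.
move=> a; apply: blkP => j; have [_ _ ->] := bP j.
by rewrite -[RHS]/(_ *: (_ *m _ *m _)) /blk_dagger inE.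
Qed.

End BlockDiagonal.

(** * Rows of the image come from rows of the argument *)

Section RowPullback.
Variables (R : realType) (k : nat) (n : 'I_k -> nat).
Hypotheses (k_gt0 : (0 < k)%N) (n_gt0 : forall j, (0 < n j)%N).
Local Notation C := R[i].
Local Notation A := (blockalg R n).
Implicit Types (a b c d : A).

Variable Phi : A -> A.
Hypothesis Phi_additive : {morph Phi : a b / a + b}.
Hypothesis Phi_surj : forall b, exists a, Phi a = b.
Hypothesis Phi_orth :
  forall a b, strong_BJ_orthogonal a b -> strong_BJ_orthogonal (Phi a) (Phi b).

Definition row_pullback j (x : 'rV[C]_(n j)) i (r : 'rV[C]_(n i))
    (T : 'rV[C]_(n i) -> 'rV[C]_(n j)) :=
  [/\ {morph T : u v / u + v}, forall v, exists u, T u = v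
    & forall a, x *m Phi a j = T (r *m a i)].

(** [x (Phi a)] depends on the block [i] of [a] only, see [supported_in]. *)
Definition supported j (x : 'rV[C]_(n j)) i :=
  forall a, a i = 0 -> x *m Phi a j = 0.

Lemma PhiB a b : Phi (a - b) = Phi a - Phi b.
Proof. by apply/eqP; rewrite eq_sym subr_eq -Phi_additive subrK. Qed.

Lemma blk_inD j : {morph @blk_in R k n j : M N / M + N}.
Proof.
move=> M N; apply: blkP => i; rewrite blk_addE.
have [ij|ij] := eqVneq i j; last by rewrite !blk_in_other ?addr0.
by subst i; rewrite !blk_in_same.
Qed.

Lemma mul_ctmx_scaled j (r : 'rV[C]_(n j)) p (u : 'M[C]_(1, p)) : r != 0 ->
  r *m (((sqn r)%:C^-1 *: r^t*) *m u) = u.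
Proof.
move=> r0; rewrite mulmxA -scalemxAr row_sqn scale_scalar_mx mulVf ?mul1mx //.
by rewrite fmorph_eq0 sqn_eq0.
Qed.

(** The map [T] is computed by lifting a row [u] to an element [b] with
    [r b = u]; the result does not depend on the lift. *)
Lemma exists_row_pullback j (x : 'rV[C]_(n j)) : x != 0 ->
  exists i (r : 'rV[C]_(n i)) T, row_pullback x r T.
Proof.
move=> x0; have [a aE] := Phi_surj (blk_in (x^t* *m x) + 0).
have [i [r [r0 ra]]] := exists_top_row a k_gt0 n_gt0.
have rx b : r *m b i = 0 -> x *m Phi b j = 0.
  move=> /(top_row_orthogonal r0 ra)/Phi_orth; rewrite aE => ab.
  rewrite -[x]trmxCK; apply: (peak_orthogonal (tau := 0) x0 _ _ _ n_gt0 _ ab).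
  - by rewrite mulmx0.
  - by rewrite mul0mx.
  - by move=> l z; rewrite mul0mx sqn0 mul0r.
  - by rewrite sqn_ctmx mulr_gt0 // sqn_gt0.
pose lift u : A := blk_in (((sqn r)%:C^-1 *: r^t*) *m u).
have rlift u : r *m lift u i = u by rewrite /lift blk_in_same mul_ctmx_scaled.
have TE b : x *m Phi b j = x *m Phi (lift (r *m b i)) j.
  apply/eqP; rewrite -subr_eq0 -mulmxBr.
  have -> : Phi b j - Phi (lift (r *m b i)) j = Phi (b - lift (r *m b i)) j.
    by rewrite PhiB.
  by apply/eqP/rx; rewrite blk_subE mulmxBr rlift subrr.
exists i, r, (fun u => x *m Phi (lift u) j); split=> //.
- move=> u v; rewrite /lift mulmxDr blk_inD Phi_additive.
  by rewrite blk_addE mulmxDr.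
- move=> v.
  have [d dE] := Phi_surj (blk_in (((sqn x)%:C^-1 *: x^t*) *m v)).
  by exists (r *m d i); rewrite -TE dE blk_in_same mul_ctmx_scaled.
Qed.

Lemma pullback_supported j (x : 'rV[C]_(n j)) i (r : 'rV[C]_(n i)) T :
  row_pullback x r T -> supported x i.
Proof.
case=> TD _ TE a ai0; rewrite TE ai0 mulmx0.
by apply: (addrI (T 0)); rewrite -TD !addr0.
Qed.

Lemma row_nonvanishing j (x : 'rV[C]_(n j)) : x != 0 ->
  exists d, x *m Phi d j != 0.
Proof.
move=> x0.
have [d dE] := Phi_surj (blk_in (((sqn x)%:C^-1 *: x^t*) *m x)).
by exists d; rewrite dE blk_in_same mul_ctmx_scaled.
Qed.

Lemma supported_in j (x : 'rV[C]_(n j)) i d : supported x i ->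
  x *m Phi d j = x *m Phi (blk_in (d i)) j.
Proof.
move=> sx; apply/eqP; rewrite -subr_eq0 -mulmxBr.
have -> : Phi d j - Phi (blk_in (d i)) j = Phi (d - blk_in (d i)) j.
  by rewrite PhiB.
by apply/eqP/sx; rewrite blk_subE blk_in_same subrr.
Qed.

Lemma supported_unique j (x : 'rV[C]_(n j)) i i' : x != 0 ->
  supported x i -> supported x i' -> i = i'.
Proof.
move=> /row_nonvanishing[d xd] sx sx'; apply/eqP/negPn/negP => ii'.
by move: xd; rewrite (supported_in d sx) sx' ?eqxx // blk_in_other // eq_sym.
Qed.

(** If [x] and [y] were supported on different blocks, one of these blocks would
    affect exactly one of [x] and [y] and not affect [x + y]; but each of the three
    rows is a combination of the two others. *)
Lemma supported_const j (x y : 'rV[C]_(n j)) i i' : x != 0 -> y != 0 ->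
  supported x i -> supported y i' -> i = i'.
Proof.
move=> x0 y0 sx sy; apply/eqP/negPn/negP => ii'.
have [xy0|xy0] := eqVneq (x + y) 0.
  move/negP: ii'; apply; apply/eqP; apply: (supported_unique x0 sx) => a /sy.
  have -> : x = - y by apply/eqP; rewrite -addr_eq0 xy0.
  by move=> h; rewrite mulNmx h oppr0.
have [l [r [T /pullback_supported sxy]]] := exists_row_pullback xy0.
have key (x1 x2 : 'rV[C]_(n j)) i1 i2 : x1 != 0 -> supported x1 i1 ->
    supported x2 i2 -> supported (x1 + x2) l -> i1 != i2 -> l != i1 -> False.
  move=> /row_nonvanishing[d xd] s1 s2 s3 i12 li1; move/negP: xd; apply.
  rewrite (supported_in d s1) -[x1 in x1 *m _](addrK x2) mulmxBl.
  by rewrite s3 ?s2 ?subr0 // blk_in_other // eq_sym.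
have [li|li] := eqVneq l i; last exact: (key x y i i' x0 sx sy sxy ii' li).
have i'i : i' != i by rewrite eq_sym.
apply: (key y x i' i y0 sy sx _ i'i _); first by rewrite addrC.
by rewrite li.
Qed.

Lemma block_pullback : exists p : 'I_k -> 'I_k, forall j (x : 'rV[C]_(n j)),
  x != 0 -> exists (r : 'rV[C]_(n (p j))) T, row_pullback x r T.
Proof.
have e0 j : (delta_mx 0 (Ordinal (n_gt0 j)) : 'rV[C]_(n j)) != 0.
  by rewrite -sqn_eq0 sqn_delta oner_eq0.
pose p j := sval (cid (exists_row_pullback (e0 j))).
exists p => j x x0.
have [r [T /pullback_supported sp]] := svalP (cid (exists_row_pullback (e0 j))).
have [i [r' [T' rT]]] := exists_row_pullback x0.
have ip := supported_const x0 (e0 j) (pullback_supported rT) sp.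
by move: r' T' rT; rewrite ip => r' T' rT; exists r', T'.
Qed.

Section Separation.
Variables (p : 'I_k -> 'I_k) (Y : forall j, 'M[C]_(n j, n (p j))).
Hypothesis PhiY : forall a b, (forall j, Y j *m a (p j) = Y j *m b (p j)) ->
  Phi a = Phi b.

(** If the rows miss [c], then [Phi] does not see the rank one elements [w v], where
    [w] is a column of [c]. A preimage of [1] can then be corrected into another
    one, [t], whose block [i] has its image orthogonal to [w], hence kills some
    [z]; adding a large multiple of [w z^*] gives a third one, [a], with the top
    row [w^*]. So [a] is orthogonal to [t], yet [1] is not orthogonal to [1]. *)
Lemma rows_separate c : (forall j, Y j *m c (p j) = 0) -> c = 0.
Proof.
move=> Yc; apply: blkP => i; apply/matrixP => x0 y0; apply/eqP/negPn/negP => c0.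
pose w : 'cV[C]_(n i) := col y0 (c i).
have w0 : w != 0.
  by apply: contra c0 => /eqP/matrixP/(_ x0 0); rewrite blk0E !mxE => ->.
(* the rank one elements w v of the block i lie in the right ideal of c *)
pose E (v : 'rV[C]_(n i)) : A := c * blk_in (delta_mx y0 0 *m v).
have Ei v : E v i = w *m v.
  by rewrite /E blk_mulE blk_in_same mulmxA -colE.
have EE v : E v = blk_in (w *m v).
  apply: blkP => l; have [li|li] := eqVneq l i; last first.
    by rewrite /E blk_mulE !blk_in_other // mulmx0.
  by subst l; rewrite Ei blk_in_same.
have YE v j : Y j *m E v (p j) = 0.
  by rewrite /E blk_mulE mulmxA Yc mul0mx.
have [a0 a0E] := Phi_surj 1.
pose t := a0 - E ((sqn w)%:C^-1 *: w^t*) * a0.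
have wt : w^t* *m t i = 0.
  rewrite /t blk_subE blk_mulE Ei mulmxBr !mulmxA col_sqn.
  rewrite -scalemxAr mul_scalar_mx scalerA mulVf ?scale1r ?subrr //.
  by rewrite fmorph_eq0 sqn_eq0.
have [z z0 tz] : exists2 z : 'cV[C]_(n i), z != 0 & t i *m z = 0.
  have : \det (t i)^T == 0.
    rewrite det_tr; apply/det0P; exists (w^t*) => //.
    by rewrite -sqn_eq0 sqn_ctmx sqn_eq0.
  case/det0P => v v0 vt; exists v^T; first by rewrite trmx_eq0.
  by rewrite -[LHS]trmxK trmx_mul trmxK vt trmx0.
pose tau := blk_norm t ^+ 2.
have tau_ge0 : 0 <= tau by exact: sqr_ge0.
(* large enough for the rank one part of a to dominate t *)
pose L : R := tau / (sqn w * sqn z) + 1.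
have K_gt0 : 0 < sqn w * sqn z by rewrite mulr_gt0 // sqn_gt0.
have L_ge1 : 1 <= L by rewrite lerDr divr_ge0 // ltW.
pose x : 'rV[C]_(n i) := L%:C *: z^t*.
have tx : t i *m x^t* = 0 by rewrite ctmxZ trmxCK -scalemxAr tz scaler0.
have x0' : x != 0.
  rewrite scaler_eq0 fmorph_eq0 negb_or gt_eqF ?(lt_le_trans ltr01) //=.
  by rewrite -sqn_eq0 sqn_ctmx sqn_eq0.
have taum : tau <= sqn w * sqn x.
  rewrite /x sqnZ sqn_ctmx sqcR mulrCA -ler_pdivrMr //.
  rewrite (@le_trans _ _ L) ?lerDl // ler_eXnr //.
pose a := blk_in (w *m x) + t.
have at0 : strong_BJ_orthogonal a t.
  apply: (@top_row_orthogonal _ _ _ _ _ i (w^t*)) => //.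
    by rewrite -sqn_eq0 sqn_ctmx sqn_eq0.
  apply: (peak_top_row x0' wt tx _ n_gt0 taum) => l y.
  exact: blk_norm_bound.
have Phit : Phi t = 1.
  rewrite -a0E; apply: PhiY => j.
  by rewrite /t blk_subE blk_mulE mulmxBr mulmxA YE mul0mx subr0.
have Phia : Phi a = 1.
  by rewrite -Phit; apply: PhiY => j; rewrite /a -EE blk_addE mulmxDr YE add0r.
have := Phi_orth at0; rewrite Phit Phia => /(_ (-1)); rewrite mul1r subrr => h.
have := blk_norm_bound (1 : A) w.
have n0 : blk_norm (0 : A) = 0.
  apply/eqP; rewrite eq_le blk_norm_ge0 andbT; apply: blk_norm_le => // l y.
  by rewrite blk0E mul0mx sqn0 expr0n mul0r.
have -> : blk_norm (1 : A) = 0.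
  by apply/eqP; rewrite eq_le blk_norm_ge0 andbT -n0.
rewrite expr0n mul0r -[(1 : A) i]/(1%:M) mul1mx leNgt sqn_gt0.
by rewrite w0.
Qed.
End Separation.

(** A block that is not reached, or a rank deficient family of rows, would be missed
    by the rows; so the map between blocks is onto, hence a permutation, along which
    the dimensions cannot increase. Their sum being invariant, they are kept. *)
Lemma block_permutation : exists (p : 'S_k),
  (forall j, n (p j) = n j) /\
  forall j (x : 'rV[C]_(n j)), x != 0 -> supported x (p j).
Proof.
have [p pP] := block_pullback.
have e0 j (s : 'I_(n j)) : (delta_mx 0 s : 'rV[C]_(n j)) != 0.
  by rewrite -sqn_eq0 sqn_delta oner_eq0.
pose r j s := sval (cid (pP j _ (e0 j s))).
pose Y j := \matrix_(s < n j) r j s : 'M[C]_(n j, n (p j)).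
have YP j s : exists T, row_pullback (delta_mx 0 s : 'rV[C]_(n j)) (row s (Y j)) T.
  by rewrite rowK; exact: (svalP (cid (pP j _ (e0 j s)))).
have PhiY a b : (forall j, Y j *m a (p j) = Y j *m b (p j)) -> Phi a = Phi b.
  move=> h; apply: blkP => j; apply/row_matrixP => s.
  by have [T [_ _ TE]] := YP j s; rewrite !rowE !TE -!row_mul h.
have sep := rows_separate PhiY.
have p_surj i : exists j, p j = i.
  apply: contrapT => h.
  have : blk_in (1%:M : 'M[C]_(n i)) = 0.
    apply: sep => j; rewrite blk_in_other ?mulmx0 //.
    by apply/eqP => pj; apply: h; exists j.
  move=> /(congr1 (fun a : A => a i)); rewrite blk_in_same blk0E => /matrixP.
  move=> /(_ (Ordinal (n_gt0 i)) (Ordinal (n_gt0 i)))/eqP.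
  by rewrite !mxE eqxx oner_eq0.
have p_inj : injective p.
  pose q i := sval (cid (p_surj i)).
  have qK : cancel q p by move=> i; exact: (svalP (cid (p_surj i))).
  exact: (can_inj (canF_sym qK)).
have n_le j : (n (p j) <= n j)%N.
  suff : row_full (Y j) by rewrite /row_full => /eqP <-; exact: rank_leq_row.
  rewrite -cokermx_eq0; apply/eqP.
  rewrite -(blk_in_same (cokermx (Y j))).
  have -> // : blk_in (cokermx (Y j)) = 0.
  apply: sep => l; have [pl|pl] := eqVneq (p l) (p j); last first.
    by rewrite blk_in_other ?mulmx0.
  by rewrite (p_inj _ _ pl) blk_in_same mulmx_coker.
exists (perm p_inj); split=> j.
  rewrite permE.
  have := @leqif_sum _ predT _ _ _ (fun j _ => leqif_eq (n_le j)).
  have -> : (\sum_(i < k) n (p i) = \sum_(i < k) n i)%N.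
    rewrite [RHS](reindex_inj p_inj); apply: eq_bigr => // i _.
  by case=> _; rewrite eqxx => /esym/forallP/(_ j)/eqP.
move=> x x0; rewrite permE; have [r' [T]] := pP j x x0.
exact: pullback_supported.
Qed.

End RowPullback.

(** * One additive map for all the rows of a block *)

Section BlockPreserving.
Variables (R : realType) (k : nat) (n : 'I_k -> nat).
Hypotheses (k_gt0 : (0 < k)%N) (n_gt0 : forall j, (0 < n j)%N).
Local Notation C := R[i].
Local Notation A := (blockalg R n).
Implicit Types (a b c d : A).

Variable Phi : A -> A.
Hypothesis Phi_additive : {morph Phi : a b / a + b}.
Hypothesis Phi_surj : forall b, exists a, Phi a = b.
Hypothesis Phi_orth :
  forall a b, strong_BJ_orthogonal a b -> strong_BJ_orthogonal (Phi a) (Phi b).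
Hypothesis Phi_block : forall j (x : 'rV[C]_(n j)), x != 0 -> supported Phi x j.

(** Let [To] be the additive map attached to the row of ones and [al] the
    coordinates of the corresponding row in the basis given by [Y]. If only the
    row [s] of [Y a] is nonzero, equal to [u], then the sum of the rows of [Phi a]
    is both the row [s] of [Phi a] and [To (al_s u)]. *)
Lemma common_pullback : exists (Y : forall j, 'M[C]_(n j))
    (T : forall j, 'rV[C]_(n j) -> 'rV[C]_(n j)),
  [/\ forall j, Y j \in unitmx, forall j, {morph T j : u v / u + v},
    forall j v, exists u, T j u = v
    & forall a j s, row s (Phi a j) = T j (row s (Y j *m a j))].
Proof.
have pull j (x : 'rV[C]_(n j)) : x != 0 ->
    exists (r : 'rV[C]_(n j)) T, row_pullback Phi x r T.
  move=> x0; have [i [r [T h]]] :=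
    exists_row_pullback k_gt0 n_gt0 Phi_additive Phi_surj Phi_orth x0.
  have ij := supported_unique Phi_additive Phi_surj x0 (pullback_supported h)
    (Phi_block x0).
  by subst i; exists r, T.
have e0 j (s : 'I_(n j)) : (delta_mx 0 s : 'rV[C]_(n j)) != 0.
  by rewrite -sqn_eq0 sqn_delta oner_eq0.
pose r j s := sval (cid (pull j _ (e0 j s))).
pose Y j := \matrix_(s < n j) r j s : 'M[C]_(n j).
have YP j s : exists T, row_pullback Phi (delta_mx 0 s : 'rV[C]_(n j)) (row s (Y j)) T.
  by rewrite rowK; exact: (svalP (cid (pull j _ (e0 j s)))).
have PhiY a b : (forall j, Y j *m a j = Y j *m b j) -> Phi a = Phi b.
  move=> h; apply: blkP => j; apply/row_matrixP => s.
  by have [T [_ _ TE]] := YP j s; rewrite !rowE !TE -!row_mul h.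
have sep := @rows_separate _ _ _ k_gt0 n_gt0 _ Phi_surj Phi_orth id Y PhiY.
have Y_unit j : Y j \in unitmx.
  rewrite -row_full_unit -cokermx_eq0; apply/eqP.
  rewrite -(blk_in_same (cokermx (Y j))).
  have -> // : blk_in (cokermx (Y j)) = 0.
  apply: sep => l; have [->|lj] := eqVneq l j; last first.
    by rewrite blk_in_other ?mulmx0.
  by rewrite blk_in_same mulmx_coker.
have o0 j : (const_mx 1 : 'rV[C]_(n j)) != 0.
  apply/eqP => /matrixP/(_ 0 (Ordinal (n_gt0 j)))/eqP.
  by rewrite !mxE oner_eq0.
pose ro j := sval (cid (pull j _ (o0 j))).
pose To j := sval (cid (svalP (cid (pull j _ (o0 j))))).
have roP j : row_pullback Phi (const_mx 1 : 'rV[C]_(n j)) (ro j) (To j).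
  exact: (svalP (cid (svalP (cid (pull j _ (o0 j)))))).
pose al j := ro j *m invmx (Y j).
have rowE' a j s : row s (Phi a j) = To j (al j 0 s *: row s (Y j *m a j)).
  have [T [_ _ TE]] := YP j s; have [ToD _ ToE] := roP j.
  rewrite [LHS]rowE TE -row_mul; move: (row s _) => u.
  pose c : A := blk_in (invmx (Y j) *m (delta_mx s 0 *m u)).
  have Yc l : row l (Y j *m c j) = (l == s)%:R *: u.
    rewrite /c blk_in_same mulKVmx // row_mul row_delta_col mul_scalar_mx.
    by [].
  have T0 (T' : 'rV[C]_(n j) -> 'rV[C]_(n j)) : {morph T' : u v / u + v} -> T' 0 = 0.
    by move=> T'D; apply: (addrI (T' 0)); rewrite -T'D !addr0.
  have -> : T u = const_mx 1 *m Phi c j.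
    rewrite mulmx_sum_row (bigD1 s) //= big1 ?addr0 => [|l ls].
      by rewrite mxE scale1r rowE TE -row_mul Yc eqxx scale1r.
    have [T' [T'D _ T'E]] := YP j l.
    by rewrite rowE T'E -row_mul Yc (negbTE ls) scale0r T0 // scaler0.
  rewrite ToE; congr (To j _).
  rewrite /c blk_in_same !mulmxA -/(al j) -colE.
  by rewrite [col s _]mx11_scalar mul_scalar_mx mxE.
exists (fun j => diag_mx (al j) *m Y j), To; split.
- move=> j; rewrite unitmx_mul Y_unit andbT unitmxE det_diag unitfE.
  apply/prodf_neq0 => s _; apply/eqP => al0.
  have [d /negP[]] := row_nonvanishing Phi_surj (e0 j s).
  have [ToD _ _] := roP j.
  rewrite -rowE rowE' al0 scale0r; apply/eqP.
  by apply: (addrI (To j 0)); rewrite -ToD !addr0.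
- by move=> j; have [] := roP j.
- by move=> j; have [] := roP j.
move=> a j s; rewrite rowE' -mulmxA mul_diag_mx; congr (To j _).
by apply/rowP => l; rewrite !mxE.
Qed.

End BlockPreserving.

(** * The characterization *)

Lemma two_rows_exist (R : realType) (k : nat) (n : 'I_k -> nat) :
  (forall j, (0 < n j)%N) -> ~ star_isomorphic R n (fun _ : 'I_1 => 1%N) ->
  forall j (s : 'I_(n j)), exists l (m : 'I_(n l)), distinct_rows s m.
Proof.
move=> n_gt0 not_C j s.
have [[l lj]|one_block] := pselect (exists l, j != l).
  by exists l, (Ordinal (n_gt0 l)); rewrite /distinct_rows lj.
have [[m sm]|one_row] := pselect (exists m : 'I_(n j), s != m).
  by exists j, m; rewrite /distinct_rows -[_ != _ :> nat]/(s != m) sm orbT.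
case: not_C.
have jE l : l = j.
  by apply/eqP; rewrite eq_sym; apply/negPn/negP => lj; apply: one_block; exists l.
have sE m : m = s.
  by apply/eqP; rewrite eq_sym; apply/negPn/negP => sm; apply: one_row; exists m.
have card1 p (p_gt0 : (0 < p)%N) (q : 'I_p) : (forall m, m = q) -> p = 1%N.
  move=> qE; apply/eqP; rewrite eqn_leq p_gt0 andbT leqNgt; apply/negP => p_gt1.
  by have := congr1 val (qE (Ordinal p_gt0)); rewrite -(qE (Ordinal p_gt1)).
have nj : n j = 1%N by exact: card1 (n_gt0 j) s sE.
have k1 : k = 1%N by exact: card1 (leq_ltn_trans (leq0n j) (ltn_ord j)) j jE.
have nE : n = fun=> 1%N.
  by apply: functional_extensionality_dep => l; rewrite (jE l).
clear -k1 nE; subst k; rewrite nE; exists id; split=> //.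
by exists id.
Qed.

Theorem corollary1p3 (R : realType) (k : nat) (n : 'I_k -> nat)
  (k_gt0 : (0 < k)%N) (n_gt0 : forall j, (0 < n j)%N)
  (not_C : ~ star_isomorphic R n (fun _ : 'I_1 => 1%N))
  (not_CC : ~ star_isomorphic R n (fun _ : 'I_2 => 1%N))
  (not_M2 : ~ star_isomorphic R n (fun _ : 'I_1 => 2%N))
  (Phi : blockalg R n -> blockalg R n)
  (Phi_additive : {morph Phi : a b / a + b})
  (Phi_surjective : forall b, exists a, Phi a = b) :
  (forall a b, strong_BJ_orthogonal a b -> strong_BJ_orthogonal (Phi a) (Phi b))
  <->
  exists (pi : 'S_k) (pi_dim : forall j, n (pi j) = n j) (gamma : R)
         (u v : blockalg R n) (S : {set 'I_k}),
    [/\ 0 < gamma, blk_unitary u, blk_unitary v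
      & forall a, Phi a =
          gamma%:C%C *: (u * blk_dagger S (blk_perm pi_dim a) * v)].
Proof.
split; last first.
  case=> pi [pi_dim [gamma [u [v [S [gamma_gt0 uu vu PhiE]]]]]] a b ab.
  rewrite !PhiE; exact: (standard_preserves k_gt0 n_gt0 pi_dim S gamma_gt0 uu vu ab).
move=> Phi_orth.
have [pi [pi_dim pi_supp]] :=
  block_permutation k_gt0 n_gt0 Phi_additive Phi_surjective Phi_orth.
have rho_dim j : n ((pi^-1)%g j) = n j.
  by rewrite -[in RHS](permKV pi j) pi_dim.
(* psi undoes pi, so that Phi o psi acts block by block *)
pose psi := blk_perm (R := R) rho_dim.
have psi_twist a : psi a = blk_twist rho_dim (finset.set0 : {set _}) a.
  by apply: blkP => j; rewrite blk_twistE finset.in_set0.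
have psi_block j a : a j = 0 -> psi a (pi j) = 0.
  rewrite /psi /blk_perm; move: (rho_dim (pi j)); rewrite permK => e ->.
  by apply/matrixP => i l; rewrite castmxE !mxE.
have psiK a : psi (blk_perm pi_dim a) = a.
  by apply: blkP => j; rewrite /psi /blk_perm castmx_comp blk_cast ?permKV.
pose Phi' a := Phi (psi a).
have Phi'_additive : {morph Phi' : a b / a + b}.
  by move=> a b; rewrite /Phi' !psi_twist blk_twistD Phi_additive.
have Phi'_surj b : exists a, Phi' a = b.
  have [a <-] := Phi_surjective b.
  by exists (blk_perm pi_dim a); rewrite /Phi' psiK.
have unit1 : blk_unitary (1 : blockalg R n).
  have st1 : blk_star (1 : blockalg R n) = 1 by apply: blkP => j; exact: ctmx1.
  by split; rewrite st1 mulr1.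
have Phi'_orth a b : strong_BJ_orthogonal a b ->
    strong_BJ_orthogonal (Phi' a) (Phi' b).
  move=> ab; apply: Phi_orth.
  have := standard_preserves k_gt0 n_gt0 rho_dim finset.set0 ltr01 unit1 unit1 ab.
  by rewrite /blk_standard !mul1r !mulr1 !scale1r -!psi_twist.
have Phi'_block j (x : 'rV[R[i]]_(n j)) : x != 0 -> supported Phi' x j.
  by move=> x0 a a0; apply: (pi_supp j x x0); exact: psi_block.
have [Y [T [Y_unit T_additive T_surj Phi'E]]] := common_pullback k_gt0 n_gt0
  Phi'_additive Phi'_surj Phi'_orth Phi'_block.
have [gamma [u [v [S [gamma_gt0 uu vu standard]]]]] :=
  block_diagonal_standard n_gt0 Phi'_additive Phi'_orth Y_unit T_additive T_surj
    Phi'E (two_rows_exist n_gt0 not_C) k_gt0.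
exists pi, pi_dim, gamma, u, v, S; split=> [||| a]; [by []|by []|by []|].
by have := standard (blk_perm pi_dim a); rewrite /Phi' psiK.
Qed.
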